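(* Consider the Glauber dynamics for the hard-core model with activity $\lambda=\omega(1+\omega)^b$, $\omega>0$, on the complete tree $T_h$ with branching factor $b$, height $h$ and $n$ vertices, with a boundary condition on the leaves. Then the following hold. 1. For all $\omega\le \ln b/b$ and every boundary condition, $$\Omega(n)\ \le\ T_{\rm relax}\ \le\ O\left(n^{1+o_b(1)}\right).$$ 2. For all $\delta>0$ and $\omega=(1+\delta)\ln b/b$: (a) for every boundary condition, $$T_{\rm relax}\le O\left(n^{1+\delta+o_b(1)}\right);$$ (b) there exists a sequence of boundary conditions $(\Gamma_h)_h$, with $\Gamma_h$ a boundary condition on $T_h$, such that, as $h\to\infty$, the Glauber dynamics on $T_h$ with boundary condition $\Gamma_h$ satisfies $$T_{\rm relax}=\Omega\left(n^{1+\delta/2-o_b(1)}\right).$$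
   Context: $T_h$ is the rooted tree in which every non-leaf vertex (including the root) has exactly $b\ge 2$ children and all leaves are at distance $h$ from the root; $V$ is its vertex set, $n=|V|$, $L$ its set of leaves. An independent set $\sigma$ is identified with an element of $\{0,1\}^V$ ($\sigma(v)=1$ means $v$ is occupied). A boundary condition is a subset $\Gamma\subseteq L$; $\Omega_\Gamma$ is the set of independent sets $\sigma$ of $T_h$ with $\sigma\cap L=\Gamma$, and the Gibbs measure $\mu_{h,\Gamma}$ on $\Omega_\Gamma$ is proportional to $\lambda^{|\sigma|}$. The (heat-bath) Glauber dynamics is the Markov chain $(X_t)$ on $\Omega_\Gamma$ which in each step chooses $v\in V$ uniformly at random, keeps $X_{t+1}(w)=X_t(w)$ for all $w\ne v$, and (leaves being held fixed to the boundary condition) if $v$ is not a leaf: if all neighbours of $v$ are unoccupied it sets $X_{t+1}(v)=1$ with probability $\lambda/(1+\lambda)$ and $0$ otherwise; if some neighbour is occupied it sets $X_{t+1}(v)=0$. Its stationary distribution is $\mu_{h,\Gamma}$. The relaxation time is $T_{\rm relax}=1/(1-\gamma)$, where $\gamma$ is the second largest absolute value of an eigenvalue of the transition matrix (i.e. $\gamma=\max\{\gamma_2,|\gamma_{|\Omega_\Gamma|}|\}$ for eigenvalues $\gamma_1\ge\gamma_2\ge\dots$). Asymptotics are as $h\to\infty$ (equivalently $n\to\infty$), with hidden constants not depending on $h$. The symbol $o_b(1)$ denotes a quantity not depending on $h$ and tending to $0$ as $b\to\infty$ (for fixed $\delta$ in part 2); more precisely it stands for a function $f(b)=O((\ln\ln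 b)^2/\ln b)$ in the upper bounds and for a function $g(b)=O(\ln\ln b/\ln b)$ in the lower bound 2(b). *)

(* Defs.v *)
From HB Require Import structures.
From mathcomp Require Import all_boot all_order all_algebra.
From mathcomp Require Export polyrcf.
From mathcomp Require Export boolp classical_sets filter reals topology normedtype sequences exp landau.
Set Implicit Arguments.
Unset Strict Implicit.
Unset Printing Implicit Defensive.
Import Order.TTheory GRing.Theory Num.Theory.
Import numFieldNormedType.Exports.
Local Open Scope ring_scope.

(* A vertex of T_h is the word of child labels read along the path from the
   root to it; the word has length at most h and the root is the empty word. *)
Definition vertex (b h : nat) : finType := h.-bseq 'I_b.

Section Tree.
Variables b h : nat.
Implicit Types (u v w : vertex b h) (s t G : {set vertex b h}).

Definition child u v : bool := [exists i : 'I_b, (v : seq 'I_b) == rcons u i].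

Definition adjacent u v : bool := child u v || child v u.

Definition leaves : {set vertex b h} := [set v : vertex b h | size v == h]%SET.

Definition independent s : bool :=
  [forall u in s, forall v in s, ~~ adjacent u v].

Definition configurations G : {set {set vertex b h}} :=
  [set s : {set vertex b h} | independent s && (s :&: leaves == G)%SET]%SET.

End Tree.

Section Glauber.
Variables (R : realType) (b h : nat) (lambda : R).
Implicit Types (v w : vertex b h) (s t G : {set vertex b h}).

Definition update_prob v s t : R :=
  if v \in leaves b h then (t == s)%:R
  else if [forall w, adjacent v w ==> (w \notin s)] then
    lambda / (1 + lambda) * (t == v |: s)%SET%:R
      + 1 / (1 + lambda) * (t == s :\ v)%SET%:R
  else (t == s :\ v)%SET%:R.

Definition step_prob s t : R :=
  \sum_(v : vertex b h) #|vertex b h|%:R^-1 * update_prob v s t.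

Definition glauber_mx G : 'M[R]_#|configurations G| :=
  \matrix_(i, j) step_prob (enum_val i) (enum_val j).

End Glauber.

(* Real eigenvalues in nonincreasing order, repeated according to algebraic
   multiplicity.  For a reversible transition matrix these are all the
   eigenvalues. *)
Definition eigenvalues (R : realType) (n : nat) (A : 'M[R]_n) : seq R :=
  let p := char_poly A in
  flatten [seq nseq (mup x p) x | x <- rev (rootsR p)].

(* With gamma_1 >= ... >= gamma_N the eigenvalues of A, this is
   max(gamma_2, |gamma_N|).  It is meaningful only for N >= 2, which for the
   Glauber dynamics on T_h holds under every boundary condition once h >= 2:
   the root can then be occupied or not, all other inner vertices being
   unoccupied. *)
Definition second_eigenvalue (R : realType) (n : nat) (A : 'M[R]_n) : R :=
  let s := eigenvalues A in Num.max (nth 0 s 1) `|last 0 s|.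

Definition relaxation_time (R : realType) (b h : nat) (lambda : R)
    (G : {set vertex b h}) : R :=
  1 / (1 - second_eigenvalue (glauber_mx lambda G)).

Definition activity (R : realType) (b : nat) (omega : R) : R :=
  omega * (1 + omega) ^+ b.

(* Main.v *)
Require Import Defs.
From mathcomp Require Import all_boot all_order all_algebra.
From mathcomp Require Import boolp classical_sets filter reals topology normedtype sequences exp landau.
From mathcomp Require Import complex ring lra.
Set Implicit Arguments.
Unset Strict Implicit.
Unset Printing Implicit Defensive.
Import Order.TTheory GRing.Theory Num.Theory.
Import numFieldNormedType.Exports.
Local Open Scope classical_set_scope.
Local Open Scope ring_scope.

(** Both bounds go through the Poincare inequality between the variance of a
    function f under the Gibbs measure and its energy, the sum over the vertices
    of the mean conditional variance given the rest of the configuration.  One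
    step of the dynamics on n vertices has the Dirichlet form energy / n.  Its
    transition matrix is reversible and positive semidefinite, hence
    diagonalizable with eigenvalues in the unit interval, and the relaxation time
    is n times the best constant in the Poincare inequality
    ([relaxation_time_le], [relaxation_time_ge]).

    Upper bounds.  Under every boundary condition the constant grows by at most the
    factor [2 * (1 + lam)] per level, where lam is the activity.  The subtrees of
    the root are independent given the root, so that the variance given the root
    tensorizes ([Var_prodw_le]).  What remains is the variance between the two
    states of the root, and it is absorbed by updates of the root at the price of
    a factor of order lam ([Var_node_le]), since the subtrees of an occupied root
    have the law of those of a vacant root conditioned on vacant children.  For
    [om <= (1 + delta) * ln b / b] the activity is at most
    [(1 + delta) * ln b * b ^ delta], and h levels give the h-th power of this, while
    [b ^ h] is at most n.

    Lower bounds.  The event that the root is occupied is affected by the updates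
    of a single vertex, which always gives a relaxation time of at least n.  For
    the slow boundary condition, om is a fixed point of the recursion of the odds
    [lam * \prod_i (1 - p i)] of a vertex in terms of the occupation probabilities
    p i of its children.  Since that fixed point is repelling, a boundary condition
    is built from the leaves to the root: from one condition with odds below om and
    one above, mixed among the children in a suitable proportion, one obtains such a
    pair for the next level, with the upper odds bounded by om times one plus the
    previous upper odds ([boundary_step]).  The odds then stay of order om at all
    but boundedly many levels.

    The test function is the estimate of the state of the root which declares a
    vertex occupied exactly when all its children are declared vacant.  It is
    mostly right, because a vacant vertex has about (1 + delta) ln b occupied
    children, so that none of them is recognized with probability about
    b ^ - (1 + delta).  An update far below changes the estimate only if all the
    siblings along its path to the root are declared vacant; this costs nothing
    below occupied vertices and b ^ - (1 + delta) below vacant ones, and occupied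
    vertices are never adjacent.  The expected number of such updates hence decays
    like b ^ (- delta / 2) per level up to logarithms ([estimator_bounds]), whereas
    the variance of the estimate does not decay ([estimator_variance]). *)

Local Notation adjacent := Defs.adjacent.

(** * Spectrum of a reversible matrix *)

(** Over the complex numbers S is Hermitian, hence unitarily diagonalizable with
    real spectrum, and two real matrices that are similar over the complex
    numbers are already similar over the reals. *)
Lemma symmetric_diagonalizable (R : rcfType) n (S : 'M[R]_n) : S^T = S ->
  exists2 P : 'M[R]_n, P \in unitmx &
    exists d : 'rV[R]_n, P *m S = diag_mx d *m P.
Proof.
move=> Ssym; pose toC := real_complex R.
have toC_real m p (M : 'M[R]_(m, p)) : map_mx toC M \is a mxOver Num.real.
  by apply/mxOverP => i j; rewrite mxE; apply/complex_realP; exists (M i j).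
have of_real m p (M : 'M[R[i]]_(m, p)) : M \is a mxOver Num.real ->
    exists N : 'M[R]_(m, p), M = map_mx toC N.
  move=> /mxOverP Mr; exists (map_mx (@complex.Re R) M).
  by apply/matrixP => i j; rewrite !mxE /toC RRe_real.
pose SC := map_mx toC S.
have SC_herm : SC \is hermsymmx.
  apply: realsym_hermsym (toC_real _ _ _).
  by apply/is_hermitianmxP; rewrite expr0 scale1r map_mx_id // map_trmx Ssym.
have /of_real[d dE] := hermitian_spectral_diag_real SC_herm.
have /hermitian_normalmx /orthomx_spectralP eqSC := SC_herm.
have diag_real : diag_mx (spectral_diag SC) \is a mxOver Num.real.
  by rewrite dE -map_diag_mx toC_real.
have simSC : mxred.similar_in unitmx SC (diag_mx (spectral_diag SC)).
  exists (spectralmx SC); first exact: spectral_unit.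
  apply/mxred.similarP; first exact: spectral_unit.
  by rewrite {2}eqSC -mulmxA mulKVmx ?spectral_unit.
have [P] := real_similar simSC (toC_real _ _ S) diag_real.
rewrite inE => /andP[/of_real[Q ->]]; rewrite map_unitmx => Qu.
move/mxred.similarP; rewrite map_unitmx => /(_ Qu).
rewrite dE -map_diag_mx -!map_mxM => /map_mx_inj eqQ.
by exists Q => //; exists d.
Qed.

(** Conjugation by the diagonal matrix of the square roots of w turns detailed
    balance into symmetry. *)
Lemma reversible_diagonalizable (R : rcfType) n (A : 'M[R]_n)
    (w : 'I_n -> R) :
  (forall i, 0 < w i) -> (forall i j, w i * A i j = w j * A j i) ->
  exists2 F : 'M[R]_n, F \in unitmx &
    exists d : 'rV[R]_n, A *m F = F *m diag_mx d.
Proof.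
move=> w_gt0 rev; pose q i := Num.sqrt (w i).
have q_gt0 i : 0 < q i by rewrite sqrtr_gt0.
have q_neq0 i : q i != 0 by rewrite gt_eqF.
have q2 i : q i * q i = w i by rewrite -expr2 sqr_sqrtr // ltW.
pose S : 'M[R]_n := \matrix_(i, j) (q i * A i j / q j).
have [|P Pu [d eqP]] := @symmetric_diagonalizable _ _ S.
  apply/matrixP => i j; rewrite !mxE.
  apply: (mulfI (q_neq0 i)); apply: (mulfI (q_neq0 j)).
  have := rev i j; rewrite -!q2 => e.
  rewrite [LHS](_ : _ = q j * q j * A j i); last by field.
  by rewrite -e; field.
pose D := diag_mx (\row_j q j).
have DS : D *m A = S *m D.
  apply/matrixP => i j; rewrite mul_diag_mx mul_mx_diag !mxE.
  by rewrite divfK.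
have Du : D \in unitmx.
  rewrite unitmxE det_diag unitfE; apply/prodf_neq0 => i _.
  by rewrite mxE.
have Qu : P *m D \in unitmx by rewrite unitmx_mul Pu Du.
exists (invmx (P *m D)); first by rewrite unitmx_inv.
exists d; apply: (canRL (mulKmx Qu)).
rewrite mulmxA -[P *m D *m A]mulmxA DS mulmxA eqP -!mulmxA.
by rewrite (mulmxA P D) mulmxV // mulmx1.
Qed.

Lemma char_poly_similar_diag (R : fieldType) n (A F : 'M[R]_n) (d : 'rV[R]_n) :
  F \in unitmx -> A *m F = F *m diag_mx d ->
  char_poly A = \prod_(i < n) ('X - (d 0 i)%:P).
Proof.
move=> Fu eqF; pose FX := map_mx polyC F.
have detF : \det FX != 0 by rewrite det_map_mx polyC_eq0 -unitfE -unitmxE.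
have : char_poly_mx A *m FX = FX *m char_poly_mx (diag_mx d).
  by rewrite mulmxBl mulmxBr -!map_mxM eqF mul_scalar_mx mul_mx_scalar.
move/(congr1 determinant); rewrite !det_mulmx mulrC => /(mulfI detF).
rewrite -/(char_poly A) => ->; rewrite -/(char_poly (diag_mx d)).
rewrite char_poly_trig ?diag_mx_is_trig //.
by apply: eq_bigr => i _; rewrite mxE eqxx.
Qed.

(** The characteristic polynomial splits over the reals, so that no eigenvalue is
    lost in the list of its real roots with multiplicity. *)
Lemma perm_eigenvalues (R : realType) n (A F : 'M[R]_n) (d : 'rV[R]_n) :
  F \in unitmx -> A *m F = F *m diag_mx d ->
  perm_eq (eigenvalues A) (codom (d 0)).
Proof.
move=> Fu eqF; rewrite /eigenvalues (char_poly_similar_diag Fu eqF).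
rewrite (_ : \prod_(i < n) _ = \prod_(x <- codom (d 0)) ('X - x%:P)); last first.
  by rewrite big_map [RHS]big_enum.
set s := codom _; set p := \prod_(x <- s) _.
have mupE x : mup x p = count_mem x s by exact: mu_prod_XsubC.
have p0 : p != 0 by rewrite monic_neq0 // monic_prod_XsubC.
have rootsE : rev (rootsR p) =i undup s.
  move=> x; rewrite mem_rev mem_undup -(roots_on_rootsR p0) /=.
  by rewrite root_prod_XsubC.
have perm_roots : perm_eq (rev (rootsR p)) (undup s).
  apply: uniq_perm => //; last exact: undup_uniq.
  by rewrite rev_uniq (sorted_uniq lt_trans ltxx) ?sorted_roots.
rewrite (eq_map (g := fun x => nseq (count_mem x s) x)) => [|x]; last first.
  by rewrite mupE.
apply: perm_trans (perm_count_undup s).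
exact/perm_flatten/perm_map.
Qed.

Lemma sorted_eigenvalues (R : realType) n (A : 'M[R]_n) :
  sorted >=%R (eigenvalues A).
Proof.
rewrite /eigenvalues; set p := char_poly A.
have : sorted >%R (rev (rootsR p)) by rewrite rev_sorted sorted_roots.
elim: (rev _) => //= x s IH; rewrite path_sortedE; last exact: (rev_trans lt_trans).
case/andP=> /allP xs /IH {}IH; elim: (mup x p) => //= k IHk.
rewrite path_sortedE ?IHk ?andbT; last exact: (rev_trans le_trans).
apply/allP => y; rewrite mem_cat => /orP[/nseqP[-> _]|].
  exact: lexx.
by case/flattenP => t /mapP[z /xs + ->] /nseqP[->] _; exact: ltW.
Qed.

Lemma col_mulmx (R : pzSemiRingType) m n p (i : 'I_p) (A : 'M[R]_(m, n))
  (B : 'M[R]_(n, p)) : col i (A *m B) = A *m col i B.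
Proof. by rewrite !colE mulmxA. Qed.

Definition wdot (R : pzSemiRingType) n (w : 'I_n -> R) (f g : 'cV[R]_n) : R :=
  \sum_i w i * f i 0 * g i 0.

Section SpectralGap.
Variables (R : realType) (n : nat) (A : 'M[R]_n) (w : 'I_n -> R) (tau : R).
Hypotheses (w_gt0 : forall i, 0 < w i) (w_sum : \sum_i w i = 1).
Hypothesis rev : forall i j, w i * A i j = w j * A j i.
Hypothesis stoch : forall i, \sum_j A i j = 1.
Implicit Types f g : 'cV[R]_n.

Local Notation dot := (wdot w).
Local Notation var f := (dot f f - (\sum_i w i * f i 0) ^+ 2).
Local Notation energy f := (dot f f - dot f (A *m f)).

Hypothesis tau_gt0 : 0 < tau.
Hypothesis poincare : forall f, var f <= tau * energy f.
Hypothesis psd : forall f, 0 <= dot f (A *m f).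
Hypothesis n_gt1 : (1 < n)%N.

Let dotC f g : dot f g = dot g f.
Proof. by apply: eq_bigr => i _; rewrite -!mulrA (mulrC (f i 0)). Qed.

Let dot_rev f g : dot f (A *m g) = dot (A *m f) g.
Proof.
rewrite /wdot; under eq_bigr do rewrite mxE mulr_sumr.
under [RHS]eq_bigr do rewrite mxE mulr_sumr mulr_suml.
rewrite exchange_big /=; apply: eq_bigr => j _; apply: eq_bigr => i _.
by rewrite mulrACA -!mulrA mulrA [X in _ = X]mulrA -rev; ring.
Qed.

Let dotZr a f g : dot f (a *: g) = a * dot f g.
Proof. by rewrite /wdot mulr_sumr; apply: eq_bigr => i _; rewrite mxE; ring. Qed.

Let dotDr f g g' : dot f (g + g') = dot f g + dot f g'.
Proof. by rewrite /wdot -big_split; apply: eq_bigr => i _; rewrite mxE mulrDr. Qed.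

Let dot_sumr (I : Type) (r : seq I) (P : pred I) f (g : I -> 'cV[R]_n) :
  dot f (\sum_(k <- r | P k) g k) = \sum_(k <- r | P k) dot f (g k).
Proof.
elim/big_rec2: _ => [|k y1 y2 _ <-]; last exact: dotDr.
by rewrite -(scale0r f) dotZr mul0r.
Qed.

Let dot_ge0 f : 0 <= dot f f.
Proof. by apply: sumr_ge0 => i _; rewrite -mulrA -expr2 mulr_ge0 ?sqr_ge0 // ltW. Qed.

Let dot_eq0 f : dot f f = 0 -> f = 0.
Proof.
move=> /eqP; rewrite psumr_eq0 => [/allP z|i _]; last first.
  by rewrite -mulrA -expr2 mulr_ge0 ?sqr_ge0 // ltW.
apply/matrixP => i j; rewrite ord1 mxE.
have := z i (mem_index_enum _); rewrite -mulrA -expr2 mulf_eq0 gt_eqF //=.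
by rewrite sqrf_eq0 => /eqP.
Qed.

Let one : 'cV[R]_n := const_mx 1.

Let A1 : A *m one = one.
Proof.
apply/matrixP => i j; rewrite mxE [RHS]mxE -[RHS](stoch i).
by apply: eq_bigr => k _; rewrite mxE mulr1.
Qed.

Let dot1 f : dot f one = \sum_i w i * f i 0.
Proof. by apply: eq_bigr => i _; rewrite mxE mulr1. Qed.

(** By reversibility [a * dot f g] and [a' * dot f g] agree. *)
Let eig_orth a a' f g : A *m f = a *: f -> A *m g = a' *: g -> a != a' ->
  dot f g = 0.
Proof.
move=> fa ga ne; apply/eqP; have := dot_rev f g; rewrite fa ga dotZr.
rewrite (dotC (a *: f)) dotZr (dotC g) => /eqP.
by rewrite -subr_eq0 -mulrBl mulf_eq0 subr_eq0 eq_sym (negbTE ne).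
Qed.

(** Such an f is orthogonal to the constants, so that its variance is its square
    norm and its energy is [1 - a] times its square norm. *)
Let eig_bounds a f : f != 0 -> A *m f = a *: f -> a != 1 ->
  0 <= a <= 1 - tau^-1.
Proof.
move=> f0 fa a1.
have f2 : 0 < dot f f.
  by rewrite lt_neqAle dot_ge0 andbT eq_sym; apply: contra_neq f0; exact: dot_eq0.
have mean0 : \sum_i w i * f i 0 = 0.
  by rewrite -dot1; apply: eig_orth a1; rewrite // A1 scale1r.
apply/andP; split.
  by have := psd f; rewrite fa dotZr pmulr_lge0.
have := poincare f; rewrite mean0 expr0n subr0 fa dotZr.
rewrite -{1 2}[dot f f]mul1r -mulrBl mulrA ler_pM2r // => le.
by rewrite lerBrDr addrC -lerBrDr -div1r ler_pdivrMr // mulrC.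
Qed.

(** An eigenvector for the eigenvalue 1 has zero energy, hence zero variance. *)
Let eig1_const f : A *m f = f -> f = (\sum_i w i * f i 0) *: one.
Proof.
move=> fA; set m := \sum_i _; have := poincare f.
rewrite fA subrr mulr0 -/m => le; apply/eqP.
rewrite -subr_eq0; apply/eqP/dot_eq0/eqP; rewrite eq_le dot_ge0 andbT.
rewrite -scaleNr dotDr dotZr [dot _ f]dotC [dot _ one]dotC !dotDr !dotZr.
rewrite [dot one f]dotC dot1 -/m.
suff -> : dot one one = 1 by move: le; lra.
by rewrite dot1 -[RHS]w_sum; apply: eq_bigr => i _; rewrite mxE mulr1.
Qed.

Section Diag.
Variables (F : 'M[R]_n) (d : 'rV[R]_n).
Hypotheses (Fu : F \in unitmx) (eqF : A *m F = F *m diag_mx d).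

Let eigF i : A *m col i F = d 0 i *: col i F.
Proof.
rewrite -col_mulmx eqF; apply/matrixP => j k.
by rewrite mul_mx_diag !mxE mulrC.
Qed.

Let F_neq0 i : col i F != 0.
Proof.
apply/eqP => F0; have := mulVmx Fu => /(congr1 (col i)); rewrite col_mulmx F0 mulmx0.
by move=> /matrixP/(_ i 0); rewrite !mxE eqxx => /eqP; rewrite eq_sym oner_eq0.
Qed.

Let eig1_unique i j : d 0 i = 1 -> d 0 j = 1 -> i = j.
Proof.
move=> di dj; apply/eqP/negP => /negP ne.
have := eig1_const; set m := fun f => \sum_k w k * f k 0 => const.
have fi := const _ (etrans (eigF i) (etrans (congr1 (fun a => a *: _) di) (scale1r _))).
have fj := const _ (etrans (eigF j) (etrans (congr1 (fun a => a *: _) dj) (scale1r _))).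
have : invmx F *m ((m (col j F)) *: col i F - m (col i F) *: col j F) = 0.
  by rewrite {1}fi {2}fj !scalerA mulrC subrr mulmx0.
rewrite mulmxBr -!scalemxAr -!col_mulmx mulVmx // => /matrixP/(_ j 0).
rewrite !mxE eqxx eq_sym (negbTE ne) mulr0 sub0r mulr1 => /eqP.
rewrite oppr_eq0 => /eqP m0; have := F_neq0 i.
by rewrite fi -/(m (col i F)) m0 scale0r eqxx.
Qed.

Let eig1_exists : exists i, d 0 i = 1.
Proof.
pose c := invmx F *m one.
have Dc : diag_mx d *m c = c.
  by rewrite /c mulmxA -(mulKmx Fu (diag_mx d)) -eqF -!mulmxA mulKVmx // A1.
have /eqP/matrix0Pn[i [j cij]] : c <> 0.
  move=> /(congr1 (mulmx F)); rewrite mulKVmx // mulmx0 => /matrixP.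
  by move=> /(_ (Ordinal (ltnW n_gt1)) 0); rewrite !mxE => /eqP; rewrite oner_eq0.
exists i; move/matrixP: Dc => /(_ i j); rewrite mul_diag_mx mxE => /eqP.
by rewrite -subr_eq0 -{2}[c i j]mul1r -mulrBl mulf_eq0 subr_eq0 (negbTE cij) orbF => /eqP.
Qed.

Let s := eigenvalues A.
Let perm_s : perm_eq s (codom (d 0)) := perm_eigenvalues Fu eqF.

Let size_s : size s = n.
Proof. by rewrite (perm_size perm_s) size_codom card_ord. Qed.


Let s_bounds x : x \in s -> x != 1 -> 0 <= x <= 1 - tau^-1.
Proof.
rewrite (perm_mem perm_s) => /codomP[i ->] d1.
exact: (eig_bounds (F_neq0 i) (eigF i) d1).
Qed.

Let count_s (a : pred R) : count a s = #|[pred i | a (d 0 i)]|.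
Proof. by rewrite (permP perm_s) -sum1_count big_map big_enum_cond sum1_card. Qed.

Let s1_lt : exists x y t, s = [:: x, y & t] /\
  [/\ path >=%R y t, 0 <= y <= 1 - tau^-1 & y < 1].
Proof.
have := sorted_eigenvalues A; have := size_s; rewrite -/s.
have : (count_mem 1%R s <= 1)%N.
  rewrite count_s; apply/card_le1_eqP => i j; rewrite !inE => /eqP di /eqP dj.
  exact: eig1_unique.
have := s_bounds.
case: (s) => [|x [|y t]] bnd cnt sz; [by move: n_gt1; rewrite -sz| |].
  by move: n_gt1; rewrite -sz.
case/andP=> yx pt; have {}yx : y <= x := yx; exists x, y, t; split=> //.
have it_gt0 : 0 < tau^-1 by rewrite invr_gt0.
have y1 : y != 1.
  apply/eqP => y1; move: cnt; rewrite /= y1 eqxx.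
  have [//|x1] := eqVneq x 1.
  have := bnd x; rewrite !inE eqxx => /(_ isT x1) /andP[_].
  by move: yx; rewrite y1; lra.
have yb : 0 <= y <= 1 - tau^-1 by apply: bnd; rewrite // !inE eqxx orbT.
by split=> //; case/andP: yb => _; lra.
Qed.

Let second_bounds : second_eigenvalue A <= 1 - tau^-1 /\
  nth 0 s 1 <= second_eigenvalue A.
Proof.
have [x [y [t [sE [pt /andP[_ yb] yl1]]]]] := s1_lt.
split; last by rewrite le_max lexx.
have last_s : last 0 s \in s by rewrite sE /= in_cons mem_last orbT.
have last_le : last 0 s <= y.
  rewrite sE /=; move: pt; rewrite path_sortedE; last exact: (rev_trans le_trans).
  case/andP=> /allP ally _.
  by have := mem_last y t; rewrite inE => /orP[/eqP-> //|/ally].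
have /andP[l0 lb] : 0 <= last 0 s <= 1 - tau^-1.
  by apply: s_bounds; rewrite // lt_eqF // (le_lt_trans last_le).
by rewrite /second_eigenvalue -/s ge_max {1}sE /= yb ger0_norm.
Qed.

(** Expand f in eigenvectors [u i], one of which is the constant vector and drops
    out.  Those with equal eigenvalues need not be orthogonal, but those with
    distinct eigenvalues are, and this is enough to write the difference of the
    two sides as the square norm of a rescaled combination g of the [u i]. *)
Let rayleigh f : \sum_i w i * f i 0 = 0 ->
  dot f (A *m f) <= nth 0 s 1 * dot f f.
Proof.
move=> f0; have [x [y [t [sE [pt _ y_lt1]]]]] := s1_lt.
rewrite sE /=; have [i0 di0] := eig1_exists.
have dle i : i != i0 -> d 0 i <= y.
  move=> ne; rewrite leNgt; apply/negP => lt.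
  (* Only the head of s can exceed y, whereas both [d 0 i] and 1 would. *)
  have : (1 < count [pred z | y < z]%R s)%N.
    rewrite count_s; apply/card_gt1P; exists i, i0.
    by rewrite !inE lt di0 y_lt1.
  rewrite sE /= ltxx add0n (_ : count _ t = 0%N) ?addn0; first by case: (y < x).
  move: pt; rewrite path_sortedE; last exact: (rev_trans le_trans).
  case/andP=> /allP ally _; apply/eqP; rewrite -leqn0 leqNgt -has_count.
  by apply/hasPn => z /ally /= zy; rewrite -leNgt.
pose c := invmx F *m f; pose u i := c i 0 *: col i F.
have fE : f = \sum_i u i.
  rewrite -[LHS](mulKVmx Fu) -/c; apply/matrixP => i j.
  by rewrite !mxE summxE; apply: eq_bigr => k _; rewrite ord1 !mxE mulrC.
have uA i : A *m u i = d 0 i *: u i.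
  by rewrite /u -scalemxAr eigF !scalerA mulrC.
have u_orth i j : d 0 i != d 0 j -> dot (u i) (u j) = 0.
  by move=> ne; exact: eig_orth (uA i) (uA j) ne.
have u_const : u i0 = (\sum_i w i * u i0 i 0) *: one.
  by apply: eig1_const; rewrite uA di0 scale1r.
have u_one i : i != i0 -> dot (u i) one = 0.
  move=> ne; apply: (@eig_orth (d 0 i) 1); rewrite ?uA ?A1 ?scale1r //.
  by apply: contra_neq ne => di; exact: eig1_unique.
have ui0 : u i0 = 0.
  have : dot f one = dot (u i0) one.
    rewrite dotC fE dot_sumr (bigD1 i0) //= big1 ?addr0 1?dotC // => i ne.
    by rewrite dotC u_one.
  by rewrite !dot1 f0 => e; rewrite u_const -e scale0r.
have {}fE : f = \sum_(i | i != i0) u i by rewrite fE (bigD1 i0) //= ui0 add0r.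
pose g := \sum_(i | i != i0) Num.sqrt (y - d 0 i) *: u i.
suff : y * dot f f - dot f (A *m f) = dot g g.
  by move=> e; rewrite -subr_ge0 e.
have dot_sum2 (a a' : 'I_n -> R) :
    dot (\sum_(i | i != i0) a i *: u i) (\sum_(i | i != i0) a' i *: u i) =
    \sum_(i | i != i0) \sum_(j | j != i0) a i * a' j * dot (u i) (u j).
  rewrite dotC dot_sumr; apply: eq_bigr => i _; rewrite dotZr dotC dot_sumr.
  by rewrite mulr_sumr; apply: eq_bigr => j _; rewrite dotZr mulrA.
have fE1 : f = \sum_(i | i != i0) 1 *: u i.
  by rewrite fE; apply: eq_bigr => i _; rewrite scale1r.
have AfE : A *m f = \sum_(i | i != i0) d 0 i *: u i.
  by rewrite fE mulmx_sumr; apply: eq_bigr.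
rewrite AfE fE1 !dot_sum2 mulr_sumr -sumrB; apply: eq_bigr => i ni.
rewrite mulr_sumr -sumrB; apply: eq_bigr => j nj.
have [e|ne] := eqVneq (d 0 i) (d 0 j); last by rewrite (u_orth _ _ ne) !mulr0 subr0.
by rewrite e -[in RHS]expr2 sqr_sqrtr ?subr_ge0 ?dle //; ring.
Qed.

Lemma second_eigenvalue_rayleigh_diag : second_eigenvalue A <= 1 - tau^-1 /\
  forall f, \sum_i w i * f i 0 = 0 ->
    dot f (A *m f) <= second_eigenvalue A * dot f f.
Proof.
have [le1 le2] := second_bounds; split=> // f /rayleigh le.
exact: le_trans le (ler_wpM2r (dot_ge0 f) le2).
Qed.

End Diag.

Let second_eigenvalue_rayleigh : second_eigenvalue A <= 1 - tau^-1 /\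
  forall f, \sum_i w i * f i 0 = 0 ->
    dot f (A *m f) <= second_eigenvalue A * dot f f.
Proof.
have [F Fu [d eqF]] := reversible_diagonalizable w_gt0 rev.
exact: second_eigenvalue_rayleigh_diag Fu eqF.
Qed.

(** The Poincare inequality bounds every eigenvalue other than 1, and positivity
    of A prevents the last eigenvalue from having the largest absolute value. *)
Lemma relaxation_le : 1 / (1 - second_eigenvalue A) <= tau.
Proof.
have [le _] := second_eigenvalue_rayleigh.
have it_gt0 : 0 < tau^-1 by rewrite invr_gt0.
rewrite div1r -[leRHS]invrK lef_pV2 ?posrE //; lra.
Qed.

(** Subtracting its mean from f changes neither energy nor variance and makes f a
    competitor in the variational characterization of the second eigenvalue. *)
Lemma relaxation_ge f eps : 0 < eps -> 0 < var f -> energy f <= eps * var f ->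
  eps^-1 <= 1 / (1 - second_eigenvalue A).
Proof.
move=> eps_gt0 varf le; have [le2 ray] := second_eigenvalue_rayleigh.
have it_gt0 : 0 < tau^-1 by rewrite invr_gt0.
rewrite div1r lef_pV2 ?posrE //; last by lra.
rewrite -(ler_pM2r varf); apply: le_trans le.
set m := \sum_i _ in varf *; pose g := f - m *: one.
have dot11 : dot one one = 1.
  by rewrite dot1 -[RHS]w_sum; apply: eq_bigr => i _; rewrite mxE mulr1.
have g0 : \sum_i w i * g i 0 = 0.
  by rewrite -dot1 dotC /g -scaleNr dotDr dotZr dot11 dotC dot1 -/m mulr1 subrr.
have dotgg : dot g g = dot f f - m ^+ 2.
  rewrite /g -scaleNr dotDr dotZr !(dotC (_ + _)) !dotDr !dotZr dot11.
  by rewrite (dotC one) dot1 -/m; ring.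
have dotgAg : dot g (A *m g) = dot f (A *m f) - m ^+ 2.
  rewrite /g -scaleNr mulmxDr -scalemxAr A1 dotDr dotZr !(dotC (_ + _)).
  rewrite !dotDr !dotZr dot11 [dot (A *m f) one]dotC dot_rev A1.
  by rewrite (dotC one) dot1 -/m (dotC (A *m f)); ring.
have := ray _ g0; rewrite dotgg dotgAg; lra.
Qed.

End SpectralGap.

(** * Finite probability spaces and product measures *)

Section FiniteProbability.
Variable R : realType.

Definition Ex (T : finType) (w f : T -> R) : R := \sum_s w s * f s.

Definition Var (T : finType) (w f : T -> R) : R :=
  Ex w (fun s => f s ^+ 2) - Ex w f ^+ 2.

Definition distribution (T : finType) (w : T -> R) : Prop :=
  (forall s, 0 <= w s) /\ \sum_s w s = 1.

Section OneSpace.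
Variables (T : finType) (w : T -> R).
Implicit Types f g : T -> R.

Lemma eq_Ex f g : f =1 g -> Ex w f = Ex w g.
Proof. by move=> e; apply: eq_bigr => s _; rewrite e. Qed.

Lemma ExD f g : Ex w (fun s => f s + g s) = Ex w f + Ex w g.
Proof. by rewrite -big_split; apply: eq_bigr => s _; rewrite mulrDr. Qed.

Lemma ExZ a f : Ex w (fun s => a * f s) = a * Ex w f.
Proof. by rewrite /Ex mulr_sumr; apply: eq_bigr => s _; rewrite mulrCA. Qed.

Lemma Ex_sum (I : Type) (r : seq I) (P : pred I) (F : I -> T -> R) :
  Ex w (fun s => \sum_(i <- r | P i) F i s) = \sum_(i <- r | P i) Ex w (F i).
Proof.
by rewrite exchange_big; apply: eq_bigr => s _; rewrite mulr_sumr.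
Qed.

Hypothesis w_prob : distribution w.

Lemma Ex_const a : Ex w (fun=> a) = a.
Proof. by rewrite /Ex -mulr_suml (proj2 w_prob) mul1r. Qed.

Lemma ler_Ex f g : (forall s, f s <= g s) -> Ex w f <= Ex w g.
Proof. by move=> le; apply: ler_sum => s _; rewrite ler_wpM2l ?(proj1 w_prob). Qed.

Lemma Ex_ge0 f : (forall s, 0 <= f s) -> 0 <= Ex w f.
Proof. by move=> f_ge0; apply: sumr_ge0 => s _; rewrite mulr_ge0 ?(proj1 w_prob). Qed.

Lemma Ex_dist_sqr a f :
  Ex w (fun s => (f s - a) ^+ 2) = Var w f + (Ex w f - a) ^+ 2.
Proof.
transitivity (Ex w (fun s => f s ^+ 2) + - (2 * a) * Ex w f + a ^+ 2).
  rewrite -ExZ -[a ^+ 2 in RHS]Ex_const -!ExD.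
  by apply: eq_Ex => s; ring.
by rewrite /Var; ring.
Qed.

Lemma VarE f : Var w f = Ex w (fun s => (f s - Ex w f) ^+ 2).
Proof. by rewrite Ex_dist_sqr subrr expr0n addr0. Qed.

Lemma Var_ge0 f : 0 <= Var w f.
Proof. by rewrite VarE; apply: Ex_ge0 => s; exact: sqr_ge0. Qed.

Lemma sqr_Ex_le f : Ex w f ^+ 2 <= Ex w (fun s => f s ^+ 2).
Proof. by rewrite -subr_ge0 Var_ge0. Qed.

End OneSpace.

Lemma Ex_swap (S T : finType) (p : S -> R) (w : T -> R) (g : S -> T -> R) :
  Ex w (fun t => Ex p (g ^~ t)) = Ex p (fun s => Ex w (g s)).
Proof.
rewrite /Ex; under eq_bigr do rewrite mulr_sumr.
rewrite exchange_big; apply: eq_bigr => s _; rewrite mulr_sumr.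
by apply: eq_bigr => t _; rewrite mulrCA.
Qed.

(** Convexity of the variance, from the Jensen inequality for the square. *)
Lemma Var_Ex_le (S T : finType) (p : S -> R) (w : T -> R) (g : S -> T -> R) :
  distribution p -> distribution w ->
  Var w (fun t => Ex p (g ^~ t)) <= Ex p (fun s => Var w (g s)).
Proof.
move=> pP wP; rewrite VarE //.
apply: (@le_trans _ _
  (Ex w (fun t => Ex p (fun s => (g s t - Ex w (g s)) ^+ 2)))).
  apply: ler_Ex => // t; apply: le_trans (sqr_Ex_le pP _).
  rewrite le_eqVlt; apply/orP; left; apply/eqP; congr (_ ^+ 2).
  rewrite [RHS](eq_Ex p (g := fun s => g s t + -1 * Ex w (g s))) => [|s]; last by ring.
  rewrite [RHS]ExD ExZ mulN1r; congr (_ - _).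
  exact: Ex_swap.
rewrite (Ex_swap p w (fun s t => (g s t - Ex w (g s)) ^+ 2)).
by apply: ler_Ex => // s; rewrite -VarE.
Qed.

Section Product.
Variables (I T : finType).
Implicit Types (m : I -> T -> R) (x y : {ffun I -> T}) (i k : I) (s t : T).

Definition prodw m x : R := \prod_i m i (x i).

Definition upd x i t : {ffun I -> T} := [ffun k => if k == i then t else x k].

Lemma upd_same x i t : upd x i t i = t.
Proof. by rewrite ffunE eqxx. Qed.

Lemma upd_other x i t k : k != i -> upd x i t k = x k.
Proof. by rewrite ffunE => /negbTE ->. Qed.

Lemma updK x i t : upd (upd x i t) i (x i) = x.
Proof. by apply/ffunP => k; rewrite !ffunE; case: eqP => // ->. Qed.

Lemma upd_upd x i s t : upd (upd x i s) i t = upd x i t.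
Proof. by apply/ffunP => k; rewrite !ffunE; case: eqP. Qed.

Lemma updC x i k s t : i != k -> upd (upd x i s) k t = upd (upd x k t) i s.
Proof.
move=> ne; apply/ffunP => j; rewrite !ffunE.
by have [->|] := eqVneq j k; rewrite // eq_sym (negbTE ne).
Qed.

Lemma distribution_prodw m :
  (forall i, distribution (m i)) -> distribution (prodw m).
Proof.
move=> mP; split=> [x|]; first by apply: prodr_ge0 => i _; exact: (proj1 (mP i)).
by rewrite -bigA_distr_bigA big1 // => i _; exact: (proj2 (mP i)).
Qed.

Lemma Ex_prodw_prod m (g : I -> T -> R) :
  Ex (prodw m) (fun x => \prod_i g i (x i)) = \prod_i Ex (m i) (g i).
Proof.
rewrite bigA_distr_bigA; apply: eq_bigr => x _.
by rewrite -big_split.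
Qed.

(** Exchanging the i-th coordinate of x with the independent copy t is an
    involution under which the product of the two weights is invariant. *)
Lemma Ex_prodw_resample m i (u : T -> R) (H : {ffun I -> T} -> R) :
  \sum_t m i t = 1 ->
  Ex (prodw m) (fun x => \sum_t u t * H (upd x i t)) =
  \sum_(x : {ffun I -> T}) (\prod_(k | k != i) m k (x k)) * u (x i) * H x.
Proof.
move=> m1; rewrite /Ex; under eq_bigr do rewrite mulr_sumr.
rewrite pair_bigA /=.
pose swp (p : {ffun I -> T} * T) := (upd p.1 i p.2, p.1 i).
have swpK : involutive swp.
  by case=> x t; rewrite /swp /= updK upd_same.
rewrite (reindex_inj (inv_inj swpK)) /=.
rewrite -(pair_bigA _ (fun x t => prodw m (upd x i t) *
  (u (x i) * H (upd (upd x i t) i (x i))))) /=.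
apply: eq_bigr => x _; under eq_bigr do rewrite updK.
rewrite -mulr_suml -mulrA; congr (_ * _).
rewrite (eq_bigr (fun t => m i t * \prod_(k | k != i) m k (x k))) => [|t _].
  by rewrite -mulr_suml m1 mul1r.
rewrite /prodw (bigD1 i) //= upd_same; congr (_ * _).
by apply: eq_bigr => k ne; rewrite upd_other.
Qed.

Variable m : I -> T -> R.
Hypothesis mP : forall i, distribution (m i).
Implicit Types f g : {ffun I -> T} -> R.

Lemma Ex_prodw_upd i g :
  Ex (prodw m) (fun x => Ex (m i) (fun t => g (upd x i t))) = Ex (prodw m) g.
Proof.
rewrite Ex_prodw_resample ?(proj2 (mP i)) //.
by apply: eq_bigr => x _; rewrite /prodw [in RHS](bigD1 i) //= [_ * m i _]mulrC.
Qed.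

Let nu := prodw m.
Let nuP : distribution nu := distribution_prodw mP.
Let avg i g x := Ex (m i) (fun t => g (upd x i t)).
Let locvar i g := Ex nu (fun x => Var (m i) (fun t => g (upd x i t))).
(* Once all coordinates have been averaged out, f has become constant. *)
Let avgs l f := foldr avg f l.

Let avg_loss i g :
  Ex nu (fun x => g x ^+ 2) - Ex nu (fun x => avg i g x ^+ 2) = locvar i g.
Proof.
rewrite -(Ex_prodw_upd i (fun x => g x ^+ 2)) -mulN1r -ExZ -ExD.
by apply: eq_Ex => x; rewrite mulN1r.
Qed.

Let locvar_avg i k g : i != k -> locvar i (avg k g) <= locvar i g.
Proof.
move=> ne; rewrite /locvar.
rewrite -(Ex_prodw_upd k (fun x => Var (m i) (fun t => g (upd x i t)))).
apply: ler_Ex => // x.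
apply: le_trans (Var_Ex_le _ (mP k) (mP i)).
rewrite le_eqVlt; apply/orP; left; apply/eqP; rewrite /Var /avg.
by congr (_ - _ ^+ 2); apply: eq_Ex => t; [congr (_ ^+ 2)|];
  apply: eq_Ex => s; rewrite updC.
Qed.

Let avgs_loss f l : uniq l ->
  Ex nu (fun x => f x ^+ 2) - Ex nu (fun x => avgs l f x ^+ 2) <=
  \sum_(i <- l) locvar i f.
Proof.
elim: l => [|i l IH] /=; first by rewrite big_nil subrr.
case/andP=> il ul; rewrite big_cons.
have loc : locvar i (avgs l f) <= locvar i f.
  elim: l il {IH ul} => //= k l IH; rewrite inE negb_or => /andP[ik il].
  exact: le_trans (locvar_avg _ ik) (IH il).
by have := IH ul; have := avg_loss i (avgs l f); lra.
Qed.

Let avgs_upd f l i x t : i \in l -> avgs l f (upd x i t) = avgs l f x.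
Proof.
elim: l x => //= k l IH x; rewrite inE /avg => il; apply: eq_Ex => s.
have [->|ne] := eqVneq i k; first by rewrite upd_upd.
by rewrite updC // IH //; move: il; rewrite (negbTE ne).
Qed.

Let avgs_const f x y : avgs (enum I) f x = avgs (enum I) f y.
Proof.
pose z l := foldr (fun i z => upd z i (y i)) x l.
have zl l : avgs (enum I) f (z l) = avgs (enum I) f x.
  by elim: l => //= i l <-; rewrite avgs_upd // mem_enum.
rewrite -(zl (enum I)); congr (avgs _ _ _); apply/ffunP => j.
have zE l : z l j = if j \in l then y j else x j.
  by elim: l => //= i l IH; rewrite ffunE inE IH; case: eqP => [->|].
by rewrite zE mem_enum.
Qed.

Let Ex_avgs f l : Ex nu (avgs l f) = Ex nu f.
Proof. by elim: l => //= i l <-; rewrite -(Ex_prodw_upd i (avgs l f)). Qed.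

(** Averaging out one coordinate after the other loses, at each coordinate, at
    most the mean conditional variance in that coordinate, because averaging
    over the other coordinates can only decrease a conditional variance. *)
Lemma Var_prodw_le f : Var (prodw m) f <=
  \sum_i Ex (prodw m) (fun x => Var (m i) (fun t => f (upd x i t))).
Proof.
have := avgs_loss f (enum_uniq I); rewrite big_enum /=; apply: le_trans.
have [x|no] := pickP (fun _ : {ffun I -> T} => true); last first.
  by have := proj2 nuP; rewrite big_pred0 // => /eqP; rewrite eq_sym oner_eq0.
move=> _; rewrite /Var lerD2l lerN2 -/nu -(Ex_avgs f (enum I)).
rewrite (eq_Ex _ (g := fun=> avgs (enum I) f x ^+ 2)) => [|y]; last first.
  by rewrite (avgs_const f y x).
rewrite Ex_const // (eq_Ex nu (g := fun=> avgs (enum I) f x)) => [|y].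
  by rewrite Ex_const.
by rewrite (avgs_const f y x).
Qed.

End Product.
End FiniteProbability.

(** * A tree as a root with b subtrees *)

Section Vertices.
Variables b h : nat.
Implicit Types (u v : vertex b h) (i j : 'I_b).

Definition vroot : vertex b h := nil_bseq h 'I_b.

Definition vcons i u : vertex b h.+1 := cons_bseq i u.

End Vertices.
Arguments vroot {b h}.

Section TreeRecursion.
Variables b h : nat.
Implicit Types (u v : vertex b h) (w : vertex b h.+1) (i j : 'I_b).
Implicit Types (s t G : {set vertex b h.+1}) (x : {ffun 'I_b -> {set vertex b h}}).

Lemma vcons_inj i j u v : vcons i u = vcons j v -> i = j /\ u = v.
Proof. by move/(congr1 val) => -[-> e]; split=> //; apply: val_inj. Qed.

Lemma eq_vcons i j u v : (vcons i u == vcons j v) = (i == j) && (u == v).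
Proof.
apply/eqP/andP => [/vcons_inj[-> ->] //|[/eqP-> /eqP->] //].
Qed.

Lemma vcons_neq_root i u : (vcons i u == vroot) = false.
Proof. by []. Qed.

Variant vertex_spec : vertex b h.+1 -> Type :=
  | VertexRoot : vertex_spec vroot
  | VertexCons i u : vertex_spec (vcons i u).

Lemma vertexP w : vertex_spec w.
Proof.
case: w => [[|i l] lP].
  by rewrite (_ : Bseq lP = vroot); [exact: VertexRoot | exact: val_inj].
have lP' : (size l <= h)%N by [].
by rewrite (_ : Bseq lP = vcons i (Bseq lP')); [exact: VertexCons | exact: val_inj].
Qed.

(** Sums and products over the vertices split into the root and the b subtrees
    hanging from it; [big_join] does the same for sums over configurations, which
    makes every induction on the height of the tree possible. *)
Lemma big_vertex (T : Type) (idx : T) (op : Monoid.com_law idx)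
    (F : vertex b h.+1 -> T) :
  \big[op/idx]_w F w =
  op (F vroot) (\big[op/idx]_i \big[op/idx]_u F (vcons i u)).
Proof.
pose f (p : unit + 'I_b * vertex b h) :=
  if p is inr q then vcons q.1 q.2 else vroot.
pose g w : unit + 'I_b * vertex b h :=
  if val w is i :: l then inr (i, insub_bseq h l) else inl tt.
have fK : cancel f g.
  case=> [[]|[i u]] //; rewrite /f /g /=; congr (inr (_, _)).
  by apply: val_inj; rewrite /insub_bseq val_insubd size_bseq.
have gK : cancel g f.
  move=> w; case: (vertexP w) => [|i u] //.
  by rewrite -[vcons i u]/(f (inr (i, u))) fK.
rewrite (reindex f); last by exists g => w _; [exact: fK | exact: gK].
rewrite big_sumType (big_pred1 tt) => [|[]] //=.
by rewrite pair_bigA.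
Qed.

Lemma card_vertexS : #|vertex b h.+1| = (1 + b * #|vertex b h|)%N.
Proof.
rewrite -sum1_card big_vertex; congr (_ + _)%N.
by under eq_bigr do rewrite sum1_card; rewrite sum_nat_const card_ord.
Qed.

Definition branch i s : {set vertex b h} := [set u | vcons i u \in s]%SET.

Definition branches s : {ffun 'I_b -> {set vertex b h}} := [ffun i => branch i s].

Definition join (r : bool) x : {set vertex b h.+1} :=
  [set w | r && (w == vroot) || [exists i, [exists u in x i, w == vcons i u]]]%SET.

Lemma root_join r x : (vroot \in join r x) = r.
Proof.
rewrite inE eqxx andbT; case: r => //=; apply/existsP => -[j].
by case/existsP => u; rewrite eq_sym vcons_neq_root andbF.
Qed.

Lemma vcons_join r x i u : (vcons i u \in join r x) = (u \in x i).
Proof.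
rewrite inE vcons_neq_root andbF /=; apply/existsP/idP => [[j]|xu].
  by case/existsP => v /andP[vx /eqP/vcons_inj[-> ->]].
by exists i; apply/existsP; exists u; rewrite xu eqxx.
Qed.

Lemma branch_join r x i : branch i (join r x) = x i.
Proof. by apply/setP => u; rewrite inE vcons_join. Qed.

Lemma branches_join r x : branches (join r x) = x.
Proof. by apply/ffunP => i; rewrite ffunE branch_join. Qed.

Lemma join_branches s : join (vroot \in s) (branches s) = s.
Proof.
apply/setP => w; case: (vertexP w) => [|i u]; first by rewrite root_join.
by rewrite vcons_join ffunE inE.
Qed.

Lemma joinP s : exists r x, s = join r x.
Proof. by exists (vroot \in s), (branches s); rewrite join_branches. Qed.

Lemma big_join (T : Type) (idx : T) (op : Monoid.com_law idx)
    (F : {set vertex b h.+1} -> T) :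
  \big[op/idx]_s F s = \big[op/idx]_(r : bool) \big[op/idx]_x F (join r x).
Proof.
rewrite pair_bigA /=.
rewrite (reindex (fun p : bool * {ffun 'I_b -> {set vertex b h}} =>
  join p.1 p.2)) //.
exists (fun s => (vroot \in s, branches s)) => [[r x] _|s _] /=.
  by rewrite root_join branches_join.
exact: join_branches.
Qed.

Lemma setU_root_join x : vroot |: join false x = join true x.
Proof.
apply/setP => w; rewrite !inE; by case: (vertexP w) => [|i u] //=.
Qed.

Lemma setU_vcons_join r x i u :
  vcons i u |: join r x = join r (upd x i (u |: x i)).
Proof.
apply/setP => w; case: (vertexP w) => [|j v].
  by rewrite in_setU1 !root_join eq_sym vcons_neq_root.
rewrite in_setU1 !vcons_join ffunE eq_vcons.
by case: eqP => [->|] //=; rewrite in_setU1.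
Qed.

Lemma leaves_root : (vroot \in leaves b h.+1) = false.
Proof. by rewrite inE. Qed.

Lemma leaves_vcons i u : (vcons i u \in leaves b h.+1) = (u \in leaves b h).
Proof. by rewrite !inE. Qed.

Lemma adjacentC w w' : adjacent w w' = adjacent w' w.
Proof. exact: orbC. Qed.

Lemma adjacent_root_root : adjacent (@vroot b h.+1) vroot = false.
Proof. by rewrite /adjacent orbb; apply/existsP => -[]. Qed.

Lemma adjacent_root_vcons i u : adjacent vroot (vcons i u) = (u == vroot).
Proof.
apply/orP/eqP => [[/existsP[j /eqP[_ u0]]|/existsP[j]]|->].
- exact: val_inj.
- by [].
by left; apply/existsP; exists i.
Qed.

Lemma adjacent_vcons i j u v :
  adjacent (vcons i u) (vcons j v) = (i == j) && adjacent u v.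
Proof.
have childE k l (u' v' : vertex b h) :
    child (vcons k u') (vcons l v') = (k == l) && child u' v'.
  apply/existsP/andP => [[m /eqP[-> /eqP e]]|[/eqP-> /existsP[m /eqP e]]].
    by split=> //; apply/existsP; exists m.
  by exists m; rewrite /= e.
by rewrite /adjacent !childE [j == i]eq_sym -andb_orr.
Qed.

End TreeRecursion.

(** * The Dirichlet form *)

Section Energy.
Variable R : realType.

(** A two-point space with masses a and c carries the variance
    [hm a c / (a + c)] times the squared difference of the two values; the formula
    is 0 when both masses vanish, since 0 is its own inverse here. *)
Definition hm (a c : R) : R := a * c / (a + c).

Lemma hmM a c d : hm (a * c) (a * d) = a * hm c d.
Proof.
rewrite /hm -mulrDr invfM; have [->|a0] := eqVneq a 0; first by rewrite !mul0r.
transitivity (a * (c * d / (c + d)) * (a / a)); last by rewrite divff ?mulr1.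
by move: a^-1 (c + d)^-1 => u v; ring.
Qed.

Lemma hm0r a : hm a 0 = 0.
Proof. by rewrite /hm mulr0 mul0r. Qed.

Lemma hm_ge0 a c : 0 <= a -> 0 <= c -> 0 <= hm a c.
Proof. by move=> a0 c0; rewrite divr_ge0 ?mulr_ge0 ?addr_ge0. Qed.

(** The sum over v of the mean conditional variance of f given the configuration
    outside v, that is, the Dirichlet form of the dynamics that resamples each
    vertex from its conditional law at rate 1. *)
Definition energy (V : finType) (w f : {set V} -> R) : R :=
  \sum_v \sum_(s : {set V} | v \notin s)
    hm (w s) (w (v |: s)%SET) * (f (v |: s)%SET - f s) ^+ 2.

Lemma energy_ge0 (V : finType) (w f : {set V} -> R) :
  (forall s, 0 <= w s) -> 0 <= energy w f.
Proof.
move=> w0; apply: sumr_ge0 => v _; apply: sumr_ge0 => s _.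
by rewrite mulr_ge0 ?sqr_ge0 ?hm_ge0.
Qed.

Lemma energyZ (V : finType) (w f : {set V} -> R) a :
  energy w (fun s => a * f s) = a ^+ 2 * energy w f.
Proof.
rewrite /energy mulr_sumr; apply: eq_bigr => v _; rewrite mulr_sumr.
by apply: eq_bigr => s _; ring.
Qed.

Lemma eq_energy (V : finType) (w f g : {set V} -> R) :
  f =1 g -> energy w f = energy w g.
Proof.
move=> fg; apply: eq_bigr => v _; apply: eq_bigr => s _.
by rewrite !fg.
Qed.

End Energy.

Section Node.
Variables (R : realType) (b h : nat).
Implicit Types (x : {ffun 'I_b -> {set vertex b h}}) (s : {set vertex b h.+1}).
Implicit Types (f : {set vertex b h.+1} -> R).

(** The law under which the root is occupied with probability p and, given the
    state r of the root, the subtrees are independent with laws [m r i]. *)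
Definition node (p : R) (m : bool -> 'I_b -> {set vertex b h} -> R) s : R :=
  (if vroot \in s then p else 1 - p) *
    prodw (m (vroot \in s)) (branches s).

Variables (p : R) (m : bool -> 'I_b -> {set vertex b h} -> R).
Hypotheses (p01 : 0 <= p <= 1) (mP : forall r i, distribution (m r i)).

Lemma node_join r x :
  node p m (join r x) = (if r then p else 1 - p) * prodw (m r) x.
Proof. by rewrite /node root_join branches_join. Qed.

Lemma Ex_node f : Ex (node p m) f =
  p * Ex (prodw (m true)) (fun x => f (join true x)) +
  (1 - p) * Ex (prodw (m false)) (fun x => f (join false x)).
Proof.
rewrite {1}/Ex big_join big_bool /= /Ex !mulr_sumr.
by congr (_ + _); apply: eq_bigr => x _; rewrite node_join mulrA.
Qed.

Lemma distribution_node : distribution (node p m).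
Proof.
split=> [s|].
  rewrite mulr_ge0 ?(proj1 (distribution_prodw _)) //.
  by case: ifP; case/andP: p01 => // *; rewrite subr_ge0.
transitivity (Ex (node p m) (fun=> 1)).
  by apply: eq_bigr => s _; rewrite mulr1.
by rewrite Ex_node !Ex_const ?mulr1 1?addrC ?subrK //; exact: distribution_prodw.
Qed.

Lemma Var_node f :
  let E r := Ex (prodw (m r)) (fun x => f (join r x)) in
  let V r := Var (prodw (m r)) (fun x => f (join r x)) in
  Var (node p m) f =
    p * V true + (1 - p) * V false + p * (1 - p) * (E true - E false) ^+ 2.
Proof. by move=> E V; rewrite /V /Var !Ex_node -/(E true) -/(E false); ring. Qed.

(** Updates at the root compare the two slices [join true] and [join false] of
    the configuration space; every other update acts on one coordinate of the
    product measure on a slice. *)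
Lemma energy_node f :
  energy (node p m) f =
  \sum_x hm ((1 - p) * prodw (m false) x) (p * prodw (m true) x) *
    (f (join true x) - f (join false x)) ^+ 2 +
  \sum_(r : bool) (if r then p else 1 - p) * \sum_i
    Ex (prodw (m r)) (fun x => energy (m r i) (fun t => f (join r (upd x i t)))).
Proof.
rewrite /energy big_vertex; congr (_ + _).
  rewrite big_mkcond big_join big_bool /= big1 => [|x _]; last first.
    by rewrite root_join.
  rewrite add0r; apply: eq_bigr => x _.
  by rewrite root_join /= setU_root_join !node_join.
under eq_bigr => i _ do under eq_bigr => u _ do rewrite big_mkcond big_join.
under [RHS]eq_bigr do rewrite mulr_sumr.
rewrite [RHS]exchange_big /=; apply: eq_bigr => i _; rewrite exchange_big /=.
apply: eq_bigr => r _; rewrite Ex_sum mulr_sumr; apply: eq_bigr => u _.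
pose w (t : {set vertex b h}) := if u \notin t then hm (m r i t) (m r i (u |: t)%SET) else 0.
pose H (x : {ffun _}) := (f (join r (upd x i (u |: x i)%SET)) - f (join r x)) ^+ 2.
transitivity ((if r then p else 1 - p) *
    Ex (prodw (m r)) (fun x => \sum_t w t * H (upd x i t))); last first.
  congr (_ * _); apply: eq_Ex => x; rewrite [RHS]big_mkcond /=.
  apply: eq_bigr => t _; rewrite /H upd_same upd_upd /w.
  by case: ifP; rewrite // mul0r.
rewrite Ex_prodw_resample; last exact: (proj2 (mP r i)).
rewrite mulr_sumr; apply: eq_bigr => x _; rewrite vcons_join /w.
case: ifP => ux; last by rewrite mulr0 mul0r mulr0.
rewrite setU_vcons_join !node_join.
have prodE (y : {ffun _}) : (forall k, k != i -> y k = x k) ->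
    prodw (m r) y = (\prod_(k | k != i) m r k (x k)) * m r i (y i).
  move=> yx; rewrite /prodw (bigD1 i) //= mulrC; congr (_ * _).
  by apply: eq_bigr => k ne; rewrite yx.
rewrite (prodE x) // (prodE (upd _ _ _)) ?upd_same => [|k]; last exact: upd_other.
rewrite 2!(mulrA (if r then _ else _)) hmM /H.
by move: (hm _ _) => e; rewrite !mulrA.
Qed.

End Node.

(** * One level of the Poincare inequality *)

Section PoincareStep.
Variables (R : realType) (b h : nat) (p c q tau : R).
Variable m : bool -> 'I_b -> {set vertex b h} -> R.
Hypotheses (p01 : 0 <= p <= 1) (mP : forall r i, distribution (m r i)).
Hypotheses (c_ge0 : 0 <= c) (tau_ge1 : 1 <= tau) (pE : p = (1 - p) * c * q).
Hypothesis condE : forall x : {ffun 'I_b -> {set vertex b h}},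
  prodw (m false) x * [forall i, vroot \notin x i]%:R = q * prodw (m true) x.
Hypothesis branch_poincare :
  forall r i g, Var (m r i) g <= tau * energy (m r i) g.
Implicit Type f : {set vertex b h.+1} -> R.

(** Besides the variances inside the two slices, which are handled by
    tensorization, there is the squared difference of the slice means E true and
    E false.  The law of the occupied slice is the law of the unoccupied one
    conditioned on the event, of probability q, that the children of the root are
    vacant.  Going through the mean e of f over that event in the unoccupied
    slice, the part E true - e is controlled by updates of the root, which flip it
    between the two slices, and the part e - E false by the variance in the
    unoccupied slice: its square times q is at most that variance, and the
    factor [p = (1 - p) * c * q] supplies exactly the missing q. *)
Lemma Var_node_le f : Var (node p m) f <= 2 * (1 + c) * tau * energy (node p m) f.
Proof.
have nuP r : distribution (prodw (m r)) := distribution_prodw (mP r).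
pose f_ r (x : {ffun 'I_b -> {set vertex b h}}) := f (join r x).
pose E r := Ex (prodw (m r)) (f_ r); pose V r := Var (prodw (m r)) (f_ r).
pose S r := \sum_i Ex (prodw (m r)) (fun x =>
  energy (m r i) (fun t => f (join r (upd x i t)))).
pose D := Ex (prodw (m true)) (fun x => (f_ true x - f_ false x) ^+ 2).
pose e := Ex (prodw (m true)) (f_ false).
have rootE : \sum_x hm ((1 - p) * prodw (m false) x) (p * prodw (m true) x) *
    (f (join true x) - f (join false x)) ^+ 2 = p / (1 + c) * D.
  rewrite /D /Ex mulr_sumr; apply: eq_bigr => x _; rewrite mulrA; congr (_ * _).
  have pnu : p * prodw (m true) x =
      (1 - p) * prodw (m false) x * (c * [forall i, vroot \notin x i]%:R).
    transitivity ((1 - p) * c * (q * prodw (m true) x)).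
      by rewrite {1}pE; ring.
    by rewrite -condE; ring.
  rewrite [RHS]mulrAC pnu; case: [forall _, _]; last by rewrite !mulr0 hm0r mul0r.
  by rewrite mulr1 -{1}[_ * prodw _ _]mulr1 hmM /hm mul1r; ring.
have V_le r : V r <= tau * S r.
  apply: le_trans (Var_prodw_le (mP r) _) _.
  by rewrite mulr_sumr; apply: ler_sum => i _; rewrite -ExZ; apply: ler_Ex.
have S_ge0 r : 0 <= S r.
  apply: sumr_ge0 => i _; apply: Ex_ge0 => // x; apply: energy_ge0 => s.
  exact: (proj1 (mP r i)).
have D_ge0 : 0 <= D by apply: Ex_ge0 => // x; exact: sqr_ge0.
have V_ge0 r : 0 <= V r by exact: Var_ge0.
have E1e : (E true - e) ^+ 2 <= D.
  rewrite /E /e -mulN1r -ExZ -ExD; apply: le_trans (sqr_Ex_le _ _) _ => //.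
  by apply: ler_Ex => // x; rewrite mulN1r.
have eE0 : q * (e - E false) ^+ 2 <= V false.
  have q_ge0 : 0 <= q.
    have : 0 <= q * \sum_x prodw (m true) x.
      rewrite mulr_sumr; apply: sumr_ge0 => x _; rewrite -condE.
      by rewrite mulr_ge0 ?(proj1 (nuP _)) ?ler0n.
    by rewrite (proj2 (nuP true)) mulr1.
  apply: (@le_trans _ _
    (q * Ex (prodw (m true)) (fun x => (f_ false x - E false) ^+ 2))).
    by rewrite ler_wpM2l // Ex_dist_sqr // lerDr Var_ge0.
  rewrite /V VarE // /Ex mulr_sumr; apply: ler_sum => x _.
  rewrite mulrA -condE ler_wpM2r ?sqr_ge0 // ler_piMr ?(proj1 (nuP _)) //.
  by case: [forall _, _].
have p2 : p * (1 - p) * (E true - E false) ^+ 2 <=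
    2 * p * D + 2 * (1 - p) * c * V false.
  have : (E true - E false) ^+ 2 <= 2 * (E true - e) ^+ 2 + 2 * (e - E false) ^+ 2.
    have := sqr_ge0 (E true - e - (e - E false)); rewrite -subr_ge0 => le.
    by rewrite -subr_ge0; apply: le_trans le _; rewrite le_eqVlt; apply/orP; left;
      apply/eqP; ring.
  case/andP: p01 => p0 p1; have p1' : 0 <= 1 - p by rewrite subr_ge0.
  move=> /(ler_wpM2l (mulr_ge0 p0 p1')) /le_trans; apply.
  rewrite mulrDr; apply: lerD.
    rewrite (_ : _ * (2 * _) = 2 * p * ((1 - p) * (E true - e) ^+ 2)); last by ring.
    rewrite ler_wpM2l ?mulr_ge0 //; apply: le_trans E1e.
    by rewrite ler_piMl ?sqr_ge0 // gerBl.
  rewrite {1}pE (_ : _ * (2 * _) =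
    2 * (1 - p) * c * ((1 - p) * (q * (e - E false) ^+ 2))); last by ring.
  rewrite ler_wpM2l ?mulr_ge0 //; apply: le_trans (ler_wpM2l p1' eE0) _.
  by rewrite ler_piMl // gerBl.
have VarE : Var (node p m) f = p * V true + (1 - p) * V false +
  p * (1 - p) * (E true - E false) ^+ 2 := Var_node p m f.
have energyE : energy (node p m) f =
    p / (1 + c) * D + (p * S true + (1 - p) * S false).
  by rewrite energy_node // rootE big_bool.
have c1 : 1 + c != 0 by rewrite gt_eqF // ltr_wpDr.
case/andP: p01 => p0 p1; have p1' : 0 <= 1 - p by rewrite subr_ge0.
have t0 : 0 <= tau by exact: le_trans tau_ge1.
have l1 : p * V true <= 2 * (1 + c) * tau * (p * S true).
  apply: le_trans (ler_wpM2l p0 (V_le true)) _.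
  rewrite [leRHS](_ : _ = 2 * (1 + c) * (p * (tau * S true))); last by ring.
  by rewrite ler_peMl ?mulr_ge0 //; move: c_ge0; lra.
have l0 : (1 - p) * (1 + 2 * c) * V false <=
    2 * (1 + c) * tau * ((1 - p) * S false).
  apply: le_trans (ler_wpM2l _ (V_le false)) _.
    by rewrite mulr_ge0 // addr_ge0 // mulr_ge0.
  rewrite [leRHS](_ : _ = (1 - p) * (2 * (1 + c)) * (tau * S false)); last by ring.
  rewrite ler_wpM2r ?mulr_ge0 // ler_wpM2l //; lra.
have lD : 2 * p * D <= 2 * (1 + c) * tau * (p / (1 + c) * D).
  rewrite [leRHS](_ : _ = tau * (2 * p * D)); last by field.
  by rewrite ler_peMl ?mulr_ge0.
rewrite VarE energyE.
move: (2 * (1 + c) * tau) l1 l0 lD => K l1 l0 lD.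
rewrite 2!(mulrDr K) [leRHS]addrA; apply: le_trans (lerD (lerD lD l1) l0).
move: p2; clear; move: ((E true - E false) ^+ 2) (V true) (V false) => x y z.
lra.
Qed.

End PoincareStep.

(** * The Gibbs measure *)

Section Gibbs.
Variables (R : realType) (b : nat) (lam : R).
Hypothesis lam_gt0 : 0 < lam.

(** [occ G] is the probability that the root of the tree with boundary condition G
    is occupied when nothing above it interferes. *)
Fixpoint occ h : {set vertex b h} -> R :=
  match h return {set vertex b h} -> R with
  | 0 => fun G => (vroot \in G)%:R
  | h'.+1 => fun G =>
      let q := \prod_i (1 - occ (branch i G)) in lam * q / (1 + lam * q)
  end.

(** The law of the subtree below an occupied parent, which forbids its root
    ([blocked]), or below a vacant one.  A single leaf below an occupied parent
    is declared vacant whatever G says, so that the law remains a probability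
    measure; it is then only reached with probability 0. *)
Fixpoint gibbs (blocked : bool) h : {set vertex b h} -> {set vertex b h} -> R :=
  match h return {set vertex b h} -> {set vertex b h} -> R with
  | 0 => fun G s => (s == if blocked then finset.set0 else G)%:R
  | h'.+1 => fun G =>
      node (if blocked then 0 else occ G) (fun r i => gibbs r (branch i G))
  end.

Definition vacancy h (G : {set vertex b h.+1}) : R :=
  \prod_i (1 - occ (branch i G)).

Lemma occS h (G : {set vertex b h.+1}) :
  occ G = lam * vacancy G / (1 + lam * vacancy G).
Proof. by []. Qed.

Lemma occ_bounds h (G : {set vertex b h}) : 0 <= occ G <= 1.
Proof.
elim: h G => [|h IH] G; first by rewrite /= ler0n lern1 leq_b1.
have q0 : 0 <= vacancy G.
  by apply: prodr_ge0 => i _; rewrite subr_ge0; case/andP: (IH (branch i G)).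
have lq0 : 0 <= lam * vacancy G by rewrite mulr_ge0 // ltW.
have lq1 : 0 < 1 + lam * vacancy G by rewrite ltr_wpDr.
rewrite occS; apply/andP; split; first exact: divr_ge0 (ltW _).
by rewrite ler_pdivrMr // mul1r lerDr.
Qed.

Lemma vacancy_ge0 h (G : {set vertex b h.+1}) : 0 <= vacancy G.
Proof. by apply: prodr_ge0 => i _; rewrite subr_ge0; case/andP: (occ_bounds (branch i G)). Qed.

Lemma odds_gt0 h (G : {set vertex b h.+1}) : 0 < 1 + lam * vacancy G.
Proof. by rewrite ltr_wpDr // mulr_ge0 ?vacancy_ge0 // ltW. Qed.

Lemma unoccS h (G : {set vertex b h.+1}) : 1 - occ G = (1 + lam * vacancy G)^-1.
Proof.
have := odds_gt0 G; rewrite occS => /gt_eqF/negbT q0.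
by apply: (mulIf q0); rewrite mulrBl divfK // mulVf //; ring.
Qed.

(** Flipping the root of a tree whose root has vacant neighbours multiplies the
    weight by lam. *)
Lemma occ_detailed_balance h (G : {set vertex b h.+1}) :
  occ G = (1 - occ G) * lam * vacancy G.
Proof. by rewrite unoccS occS mulrC !mulrA. Qed.

Lemma distribution_gibbs blocked h (G : {set vertex b h}) :
  distribution (gibbs blocked G).
Proof.
elim: h blocked G => [|h IH] blocked G.
  split=> [s|/=]; first exact: ler0n.
  by rewrite -natr_sum (bigD1 (if blocked then finset.set0 else G)) //= eqxx big1
    // => s /negbTE ->.
apply: distribution_node => [|r i]; last exact: IH.
by case: blocked; rewrite ?lexx ?ler01 ?occ_bounds.
Qed.

(** This is the hypothesis of [Var_node_le] relating the two slices, and it lets a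
    single normalizing constant serve both laws in [gibbs_weight]. *)
Lemma gibbs_condition h (G : {set vertex b h}) s :
  gibbs false G s * (vroot \notin s)%:R = (1 - occ G) * gibbs true G s.
Proof.
case: h G s => [|h] G s.
  rewrite [occ _]/= [gibbs _ _ _]/= [gibbs true _ _]/=.
  have set0P (t : {set vertex b 0}) : (t == finset.set0) = (vroot \notin t).
    apply/eqP/idP => [->|t0]; first by rewrite inE.
    apply/setP => v; rewrite inE (_ : v = vroot) ?(negbTE t0) //.
    by apply: val_inj; case: v => -[].
  rewrite set0P; case Gr: (vroot \in G).
    by rewrite subrr mul0r; case: eqP => [->|]; rewrite ?Gr ?mulr0 ?mul0r.
  have /eqP-> : G == finset.set0 by rewrite set0P Gr.
  by rewrite subr0 mul1r set0P; case: (vroot \in s); rewrite ?mulr0 ?mulr1.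
rewrite /= /node; case: (vroot \in s); last by rewrite mulr1 subr0 mul1r.
by rewrite mulr0 mul0r mulr0.
Qed.

Lemma prodw_gibbs_condition h (G : {set vertex b h.+1})
    (x : {ffun 'I_b -> {set vertex b h}}) :
  prodw (fun i => gibbs false (branch i G)) x *
    [forall i, vroot \notin x i]%:R =
  vacancy G * prodw (fun i => gibbs true (branch i G)) x.
Proof.
rewrite /vacancy /prodw -[RHS]big_split /=.
under [RHS]eq_bigr do rewrite -gibbs_condition.
rewrite big_split /=; congr (_ * _).
case: forallP => [all|/forallP]; first by rewrite big1 // => i _; rewrite all.
rewrite negb_forall => /existsP[j /negbTE jx].
by rewrite (bigD1 j) //= jx mul0r.
Qed.

Definition weight h (G s : {set vertex b h}) : R :=
  (s \in configurations G)%:R * lam ^+ #|s|.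

Lemma configurations_join h (G : {set vertex b h.+1}) r x :
  G \subset leaves b h.+1 ->
  (join r x \in configurations G) =
  [forall i, x i \in configurations (branch i G)] &&
  (r ==> [forall i, vroot \notin x i]).
Proof.
move=> /fintype.subsetP Gl; rewrite inE.
apply/andP/andP => [[/forallP ind /eqP/setP eqG]|[/forallP conf rx]].
  have indv v w : v \in join r x -> w \in join r x -> ~~ adjacent v w.
    by move=> vx; have /implyP/(_ vx)/forallP/(_ w)/implyP := ind v.
  split.
    apply/forallP => i; rewrite inE; apply/andP; split.
      apply/forallP => u; apply/implyP => ux; apply/forallP => v; apply/implyP => vx.
      have := indv (vcons i u) (vcons i v).
      by rewrite !vcons_join adjacent_vcons eqxx => /(_ ux vx).
    apply/eqP/setP => u; have := eqG (vcons i u).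
    by rewrite !finset.in_setI vcons_join leaves_vcons => ->; rewrite inE.
  apply/implyP => rT; apply/forallP => i; apply/negP => xr.
  have := indv vroot (vcons i vroot); rewrite root_join vcons_join.
  by rewrite adjacent_root_vcons eqxx => /(_ rT xr).
split.
  apply/forallP => v; apply/implyP => vx; apply/forallP => w; apply/implyP => wx.
  have root_vcons i u : vroot \in join r x -> u \in x i -> u != vroot.
    rewrite root_join => rT; apply: contraTneq => ->.
    by have /implyP/(_ rT)/forallP := rx.
  case: (vertexP v) vx => [|i u]; case: (vertexP w) wx => [|j u'].
  - by rewrite adjacent_root_root.
  - by rewrite vcons_join => ux rT; rewrite adjacent_root_vcons (root_vcons _ _ rT ux).
  - by move=> rT; rewrite vcons_join adjacentC adjacent_root_vcons => /(root_vcons _ _ rT).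
  rewrite !vcons_join adjacent_vcons => u'x ux.
  case: eqP => //= ij; subst j; have := conf i; rewrite inE => /andP[/forallP ind _].
  by have /implyP/(_ ux)/forallP/(_ u')/implyP/(_ u'x) := ind u.
apply/eqP/setP => v; rewrite finset.in_setI; case: (vertexP v) => [|i u].
  rewrite leaves_root andbF; apply/esym/negbTE/negP => /Gl.
  by rewrite leaves_root.
rewrite vcons_join leaves_vcons; have := conf i; rewrite inE => /andP[_ /eqP/setP].
by move=> /(_ u); rewrite finset.in_setI => ->; rewrite inE.
Qed.

Lemma card_join h r (x : {ffun 'I_b -> {set vertex b h}}) :
  #|join r x| = (r + \sum_i #|x i|)%N.
Proof.
rewrite -sum1_card big_mkcond big_vertex /= root_join; congr (_ + _)%N.
apply: eq_bigr => i _; rewrite -sum1_card [RHS]big_mkcond.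
by apply: eq_bigr => u _; rewrite vcons_join.
Qed.

Lemma weight_join h (G : {set vertex b h.+1}) r x : G \subset leaves b h.+1 ->
  weight G (join r x) =
  (r ==> [forall i, vroot \notin x i])%:R * lam ^+ r *
    prodw (fun i => weight (branch i G)) x.
Proof.
move=> Gl; rewrite /weight configurations_join // card_join exprD.
rewrite -mulnb natrM /prodw big_split /= prodrXr.
suff -> : \prod_i (x i \in configurations (branch i G))%:R =
    [forall i, x i \in configurations (branch i G)]%:R :> R by ring.
case: forallP => [all|/forallP]; first by rewrite big1 // => i _; rewrite all.
rewrite negb_forall => /existsP[j /negbTE jx].
by rewrite (bigD1 j) //= jx mul0r.
Qed.

Lemma branch_leaves h (G : {set vertex b h.+1}) i :
  G \subset leaves b h.+1 -> branch i G \subset leaves b h.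
Proof.
by move=> /fintype.subsetP Gl; apply/fintype.subsetP => u; rewrite inE => /Gl; rewrite leaves_vcons.
Qed.

(** The weight of a configuration is the product of the weights of its branches
    times that of the root; below an occupied root, [gibbs_condition] turns the
    free laws of the branches, restricted to vacant roots, into blocked ones. *)
Lemma gibbs_weight h (G : {set vertex b h}) : G \subset leaves b h ->
  exists2 Z, 0 < Z & forall s, gibbs false G s = weight G s / Z.
Proof.
elim: h G => [|h IH] G Gl.
  exists (lam ^+ #|G|) => [|s]; first exact: exprn_gt0.
  rewrite [gibbs _ _ _]/= /weight inE.
  have -> : (s :&: leaves b 0)%SET = s.
    by apply/finset.setIidPl/fintype.subsetP => v _; rewrite inE; case: v => -[].
  have -> : independent s.
    apply/forallP => u; apply/implyP => _; apply/forallP => v; apply/implyP => _.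
    apply/norP; split; apply/existsP => -[k /eqP];
      by case: u v => -[|? ?] // ? [] [|? ?].
  case: eqP => [->|]; rewrite ?mul0r // mul1r divff //.
  by rewrite expf_neq0 // gt_eqF.
have /boolp.choice[Z ZP] : forall i, exists Zi, 0 < Zi /\
    forall s, gibbs false (branch i G) s = weight (branch i G) s / Zi.
  move=> i; have [Z Z0 ZE] := IH _ (branch_leaves i Gl).
  by exists Z.
have Z0 : 0 < \prod_i Z i by apply: prodr_gt0 => i _; case: (ZP i).
have u0 : 0 < 1 - occ G by rewrite unoccS invr_gt0 odds_gt0.
exists (\prod_i Z i / (1 - occ G)) => [|s]; first exact: divr_gt0.
have [r [x ->]] := joinP s; rewrite weight_join // [gibbs _ _]/= node_join.
have prodE : prodw (fun i => gibbs false (branch i G)) x =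
    prodw (fun i => weight (branch i G)) x / \prod_i Z i.
  rewrite /prodw -prodf_div; apply: eq_bigr => i _.
  by case: (ZP i) => _ ->.
rewrite invf_div; case: r => /=; last first.
  by rewrite prodE !mul1r -/(occ _); ring.
rewrite -/(vacancy G) -occS {1}occ_detailed_balance -!mulrA.
rewrite -prodw_gibbs_condition prodE.
by move: (\prod_i Z i)^-1 => z; ring.
Qed.

(** Each level costs the factor of the one-level inequality; blocking the root is
    the case of that inequality with activity 0 at the root. *)
Lemma gibbs_poincare blocked h (G : {set vertex b h}) f :
  Var (gibbs blocked G) f <= (2 * (1 + lam)) ^+ h * energy (gibbs blocked G) f.
Proof.
have K1 : 1 <= 2 * (1 + lam) by move: lam_gt0; lra.
have Kn n : 1 <= (2 * (1 + lam)) ^+ n by exact: exprn_ege1.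
elim: h blocked G f => [|h IH] blocked G f.
  rewrite expr0 mul1r; set s0 : {set vertex b 0} := if blocked then finset.set0 else G.
  have ExE g : Ex (gibbs blocked G) g = g s0.
    rewrite /Ex (bigD1 s0) //= eqxx mul1r big1 ?addr0 // => s /negbTE.
    by rewrite -/s0 => ->; rewrite mul0r.
  by rewrite /Var !ExE subrr energy_ge0.
have mP r i : distribution (gibbs r (branch i G)) by exact: distribution_gibbs.
have IHG r i g := IH r (branch i G) g.
rewrite exprS; case: blocked => /=.
  have p01 : 0 <= (0 : R) <= 1 by apply/andP; split; rewrite ?lexx ?ler01.
  apply: le_trans (@Var_node_le _ _ _ 0 0 (vacancy G) _ _ p01 mP _ (Kn h) _
    (prodw_gibbs_condition G) IHG f) _; rewrite ?lexx ?mulr0 ?mul0r //.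
  rewrite ler_wpM2r //.
    by apply: energy_ge0; exact: (proj1 (distribution_node p01 mP)).
  rewrite ler_wpM2r ?(le_trans ler01) //; move: lam_gt0; lra.
exact: (@Var_node_le _ _ _ _ lam (vacancy G) _ _ (occ_bounds G) mP (ltW lam_gt0)
  (Kn h) (occ_detailed_balance G) (prodw_gibbs_condition G) IHG f).
Qed.

End Gibbs.

(** * The Glauber dynamics *)

Section TwoPoint.
Variables (R : realType) (V : finType).
Implicit Types (s t : {set V}) (v : V) (w f : {set V} -> R).

Lemma big_toggle v (F : {set V} -> R) :
  \sum_s F s = \sum_(s : {set V} | v \notin s) (F s + F (v |: s)%SET).
Proof.
rewrite big_split /= (bigID (fun s : {set V} => v \notin s)) /=; congr (_ + _).
rewrite (reindex_onto (fun s => v |: s)%SET (fun s => s :\ v)%SET) /=.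
  apply: eq_bigl => s; rewrite setU11 /=.
  by apply/eqP/idP => [<-|vs]; [rewrite setD11 | rewrite setU1K].
by move=> s; rewrite negbK; exact: finset.setD1K.
Qed.

Lemma setD1_eq v s t :
  (t :\ v == s :\ v)%SET = (t == s :\ v)%SET || (t == v |: s)%SET.
Proof.
have [vt|vt] := boolP (v \in t).
  have -> : (t == s :\ v)%SET = false.
    by apply/negbTE; apply: contraTneq vt => ->; rewrite setD11.
  apply/eqP/eqP => [e|->]; last by apply/setP => x; rewrite !inE; case: eqP.
  by rewrite -(finset.setD1K vt) e; apply/setP => x; rewrite !inE; case: eqP.
have -> : (t == v |: s)%SET = false.
  by apply/negbTE; apply: contraNneq vt => ->; rewrite setU11.
have -> : (t :\ v = t)%SET.
  by apply/setP => x; rewrite !inE; case: eqP => // ->; rewrite (negbTE vt).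
by rewrite orbF.
Qed.

(** Only updates of v matter, and the conditional variance of an event is on
    average at most its variance.  The proof bounds [hm] by its tangent planes
    [t ^+ 2 * a + (1 - t) ^+ 2 * c]; here t is the probability of the event. *)
Lemma energy_mem_le v w : distribution w ->
  energy w (fun s => (v \in s)%:R) <= Var w (fun s => (v \in s)%:R).
Proof.
move=> wP; set p := Ex w (fun s => (v \in s)%:R).
have pE : \sum_(s : {set V} | v \notin s) w (v |: s)%SET = p.
  rewrite /p /Ex (big_toggle v); apply: eq_bigr => s vs.
  by rewrite (negbTE vs) setU11 mulr0 mulr1 add0r.
have qE : \sum_(s : {set V} | v \notin s) w s = 1 - p.
  by rewrite -[1](proj2 wP) (big_toggle v) big_split /= pE addrK.
have -> : Var w (fun s => (v \in s)%:R) = p ^+ 2 * (1 - p) + (1 - p) ^+ 2 * p.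
  rewrite /Var -/p (eq_Ex w (g := fun s => (v \in s)%:R)) -/p; first by ring.
  by move=> s; case: (v \in s); rewrite ?expr1n ?expr0n.
have -> : p ^+ 2 * (1 - p) + (1 - p) ^+ 2 * p =
    \sum_(s : {set V} | v \notin s)
      (p ^+ 2 * w s + (1 - p) ^+ 2 * w (v |: s)%SET).
  by rewrite big_split /= -!mulr_sumr pE qE.
rewrite /energy (bigD1 v) //= [X in _ + X]big1 ?addr0 => [|u uv]; last first.
  apply: big1 => s us; rewrite finset.in_setU1 eq_sym (negbTE uv).
  by rewrite subrr expr0n mulr0.
apply: ler_sum => s vs; rewrite setU11 (negbTE vs) subr0 expr1n mulr1.
have := proj1 wP s; have := proj1 wP (v |: s)%SET.
move: (w s) (w _) => a c c0 a0; rewrite /hm.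
have [ac|ac] := eqVneq (a + c) 0.
  by rewrite ac invr0 mulr0 addr_ge0 // mulr_ge0 // sqr_ge0.
rewrite ler_pdivrMr; last by rewrite lt_neqAle eq_sym ac addr_ge0.
rewrite -subr_ge0 (_ : _ - _ = (p * a - (1 - p) * c) ^+ 2) ?sqr_ge0 //; ring.
Qed.

End TwoPoint.

(** In the section below functions on the whole power set stand for vectors
    indexed by the configurations, and sums over configurations are extended by
    the vanishing of the Gibbs measure elsewhere. *)
Section Chain.
Variables (R : realType) (b h : nat) (lam : R) (G : {set vertex b h}).
Hypotheses (lam_gt0 : 0 < lam) (Gl : G \subset leaves b h).
Implicit Types (s t : {set vertex b h}) (v u : vertex b h).
Implicit Types (f g : {set vertex b h} -> R).

Local Notation Omega := (configurations G).
Local Notation w := (gibbs lam false G).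

Lemma gibbs_out s : s \notin Omega -> w s = 0.
Proof.
move=> sO; have [Z _ ->] := gibbs_weight lam_gt0 Gl.
by rewrite /weight (negbTE sO) !mul0r.
Qed.

Lemma gibbs_gt0 s : s \in Omega -> 0 < w s.
Proof.
move=> sO; have [Z Z0 ->] := gibbs_weight lam_gt0 Gl.
by rewrite /weight sO mul1r divr_gt0 // exprn_gt0.
Qed.

Lemma gibbs_setU1 v s : v \notin s -> s \in Omega -> (v |: s)%SET \in Omega ->
  w (v |: s)%SET = lam * w s.
Proof.
move=> vs sO vsO; have [Z _ wE] := gibbs_weight lam_gt0 Gl.
by rewrite !wE /weight sO vsO cardsU1 vs !mul1r exprS mulrA.
Qed.

Lemma adjacentxx v : adjacent v v = false.
Proof.
rewrite /Defs.adjacent orbb; apply/existsP => -[k /eqP/(congr1 size)].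
by rewrite size_rcons => /n_Sn.
Qed.

Lemma configurations_setD1 v s : v \notin leaves b h -> s \in Omega ->
  (s :\ v)%SET \in Omega.
Proof.
move=> vl; rewrite !inE => /andP[/forallP ind /eqP <-]; apply/andP; split.
  apply/forallP => x; apply/implyP; rewrite in_setD1 => /andP[_ xs].
  apply/forallP => y; apply/implyP; rewrite in_setD1 => /andP[_ ys].
  by have /implyP/(_ xs)/forallP/(_ y)/implyP/(_ ys) := ind x.
apply/eqP/setP => x; rewrite !finset.in_setI in_setD1.
by case: eqP => // ->; rewrite (negbTE vl) !andbF.
Qed.

Lemma configurations_setU1 v s : v \notin leaves b h -> s \in Omega ->
  ((v |: s)%SET \in Omega) = [forall u, adjacent v u ==> (u \notin s)].
Proof.
move=> vl; rewrite !inE => /andP[/forallP ind /eqP <-].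
have -> : ((v |: s) :&: leaves b h == s :&: leaves b h)%SET.
  apply/eqP/setP => x; rewrite !finset.in_setI finset.in_setU1.
  by case: eqP => // ->; rewrite (negbTE vl) !andbF.
rewrite andbT; apply/forallP/forallP => free x.
  apply/implyP => vx; apply/negP => xs.
  have /implyP := free v; rewrite setU11 => /(_ isT)/forallP/(_ x)/implyP.
  by rewrite finset.in_setU1 xs orbT vx => /(_ isT).
apply/implyP; rewrite finset.in_setU1 => xs; apply/forallP => y; apply/implyP.
rewrite finset.in_setU1 => ys.
have adjC (y' z : vertex b h) : adjacent y' z = adjacent z y' by exact: orbC.
case/orP: xs => [/eqP->|xs]; case/orP: ys => [/eqP->|ys].
- by rewrite adjacentxx.
- by apply: contraTN ys => vy; have /implyP/(_ vy) := free y.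
- by rewrite adjC; apply: contraTN xs => vx; have /implyP/(_ vx) := free x.
by have /implyP/(_ xs)/forallP/(_ y)/implyP/(_ ys) := ind x.
Qed.

Lemma configurations_leaf v s : v \in leaves b h -> s \in Omega ->
  (v \in s) = (v \in G).
Proof.
by move=> vl; rewrite !inE => /andP[_ /eqP <-]; rewrite finset.in_setI vl andbT.
Qed.

(** Updating v resamples it from the Gibbs measure conditioned on the
    configuration outside v. *)
Lemma update_probE v s t : s \in Omega ->
  update_prob lam v s t =
  (t :\ v == s :\ v)%SET%:R * w t / (w (s :\ v)%SET + w (v |: s)%SET).
Proof.
move=> sO; set a := (s :\ v)%SET; set c := (v |: s)%SET.
have ac : (c == a) = false.
  by apply/eqP => /setP/(_ v); rewrite setU11 setD11.
have -> : (t :\ v == a)%SET%:R * w t = (t == a)%:R * w a + (t == c)%:R * w c.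
  rewrite setD1_eq -/a -/c; have [->|ta] := eqVneq t a.
    by rewrite eq_sym ac /= mul0r addr0.
  by have [->|] := eqVneq t c; rewrite /= ?mul0r ?add0r.
have ws := gibbs_gt0 sO; rewrite /update_prob.
case: ifP => [vl|/negbT vl].
  have [vs|vs] := boolP (v \in s).
    have cs : c = s by apply/finset.setUidPr; rewrite finset.sub1set.
    have -> : w a = 0.
      apply: gibbs_out; apply: contraTN vs => aO.
      rewrite (configurations_leaf vl sO) -(configurations_leaf vl aO).
      by rewrite setD11.
    by rewrite cs mulr0 !add0r mulfK // gt_eqF.
  have as_ : a = s.
    by apply/setP => x; rewrite in_setD1; case: eqP => // ->; rewrite (negbTE vs).
  have -> : w c = 0.
    apply: gibbs_out; apply: contraNN vs => cO.
    rewrite (configurations_leaf vl sO) -(configurations_leaf vl cO).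
    by rewrite setU11.
  by rewrite as_ mulr0 !addr0 mulfK // gt_eqF.
have aO := configurations_setD1 vl sO; have wa := gibbs_gt0 aO.
have cO := configurations_setU1 vl sO.
case: ifP => free; rewrite -/a -/c.
  have ca : c = (v |: a)%SET.
    by apply/setP => x; rewrite !inE; case: eqP.
  have -> : w c = lam * w a.
    by rewrite ca gibbs_setU1 ?setD11 // -ca cO free.
  have wa0 : w a != 0 by rewrite gt_eqF.
  have l0 : 1 + lam != 0 by rewrite gt_eqF // addr_gt0.
  have e : w a + lam * w a = (1 + lam) * w a by ring.
  rewrite e; field; rewrite ?l0 ?wa0 //.
rewrite (gibbs_out (s := c)) ?cO ?free // mulr0 !addr0 mulfK // gt_eqF //.
Qed.

Let hb v f s := (w (s :\ v)%SET * f (s :\ v)%SET + w (v |: s)%SET * f (v |: s)%SET) /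
  (w (s :\ v)%SET + w (v |: s)%SET).

Let update_mean v f s : s \in Omega ->
  \sum_(t in Omega) update_prob lam v s t * f t = hb v f s.
Proof.
move=> sO; transitivity (\sum_t (t :\ v == s :\ v)%SET%:R * w t * f t /
    (w (s :\ v)%SET + w (v |: s)%SET)).
  rewrite big_mkcond; apply: eq_bigr => t _; rewrite update_probE // mulrAC.
  by case: ifP => // /negbT/gibbs_out ->; rewrite mulr0 !mul0r.
rewrite -mulr_suml /hb; congr (_ / _).
rewrite (bigD1 (s :\ v)%SET) //= (bigD1 (v |: s)%SET) /=; last first.
  by apply/eqP => /setP/(_ v); rewrite setU11 setD11.
have -> : ((s :\ v) :\ v == s :\ v)%SET by rewrite setD1_eq eqxx.
have -> : ((v |: s) :\ v == s :\ v)%SET by rewrite setD1_eq eqxx orbT.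
rewrite !mul1r big1 ?addr0 // => t /andP[ta tc].
by rewrite setD1_eq (negbTE ta) (negbTE tc) !mul0r.
Qed.

Let hb_sum v f : \sum_s w s * f s * hb v f s =
  \sum_(s : {set vertex b h} | v \notin s)
     (w s * f s + w (v |: s)%SET * f (v |: s)%SET) ^+ 2 / (w s + w (v |: s)%SET).
Proof.
rewrite (big_toggle v); apply: eq_bigr => s vs; rewrite /hb.
have -> : (s :\ v = s)%SET.
  by apply/setP => x; rewrite in_setD1; case: eqP => // ->; rewrite (negbTE vs).
rewrite setU1K // (_ : v |: (v |: s) = v |: s)%SET; last first.
  by rewrite finset.setUA finset.setUid.
by rewrite -mulrDl mulrA -expr2.
Qed.

Let n := #|vertex b h|.

Let n_gt0 : 0 < n%:R :> R.
Proof. by rewrite ltr0n; apply/card_gt0P; exists vroot. Qed.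

Let A := glauber_mx lam G.

Let wI (i : 'I_#|Omega|) := w (enum_val i).

Let lift (g : {set vertex b h} -> R) : 'cV[R]_#|Omega| := \col_i g (enum_val i).

Let wdot_lift f g : wdot wI (lift f) (lift g) = Ex w (fun s => f s * g s).
Proof.
transitivity (\sum_(s in Omega) w s * (f s * g s)).
  by rewrite [RHS]big_enum_val /wdot; apply: eq_bigr => i _; rewrite !mxE mulrA.
rewrite big_mkcond; apply: eq_bigr => s _; case: ifP => // /negbT/gibbs_out ->.
by rewrite mul0r.
Qed.

Let wsum_lift f : \sum_i wI i * lift f i 0 = Ex w f.
Proof.
transitivity (\sum_(s in Omega) w s * f s).
  by rewrite [RHS]big_enum_val; apply: eq_bigr => i _; rewrite !mxE.
rewrite big_mkcond; apply: eq_bigr => s _; case: ifP => // /negbT/gibbs_out ->.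
by rewrite mul0r.
Qed.

Let lift_surj (c : 'cV[R]_#|Omega|) : exists g, c = lift g.
Proof.
exists (fun s => \sum_(i | enum_val i == s) c i 0).
apply/matrixP => i j; rewrite ord1 mxE (big_pred1 i) // => k.
by rewrite (inj_eq enum_val_inj).
Qed.

Let A_lift f i : (A *m lift f) i 0 = \sum_v n%:R^-1 * hb v f (enum_val i).
Proof.
rewrite mxE; transitivity (\sum_(t in Omega)
    step_prob lam (enum_val i) t * f t).
  by rewrite [RHS]big_enum_val; apply: eq_bigr => j _; rewrite !mxE.
rewrite /step_prob; under eq_bigr do rewrite mulr_suml.
rewrite exchange_big; apply: eq_bigr => v _ /=.
rewrite -(update_mean v f (enum_valP i)) mulr_sumr.
by apply: eq_bigr => t _; rewrite mulrA.
Qed.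

(** Each single-vertex update is the conditional expectation given the rest of
    the configuration, so that its quadratic form is a sum of squares; this
    makes the transition matrix positive semidefinite. *)
Let wdot_A f : wdot wI (lift f) (A *m lift f) =
  n%:R^-1 * \sum_v \sum_(s : {set vertex b h} | v \notin s)
    (w s * f s + w (v |: s)%SET * f (v |: s)%SET) ^+ 2 / (w s + w (v |: s)%SET).
Proof.
under [in RHS]eq_bigr do rewrite -hb_sum; rewrite exchange_big mulr_sumr /=.
transitivity (\sum_(s in Omega) w s * f s * \sum_v n%:R^-1 * hb v f s).
  rewrite [RHS]big_enum_val /wdot; apply: eq_bigr => i _.
  by rewrite A_lift !mxE.
rewrite big_mkcond; apply: eq_bigr => s _; rewrite -!mulr_sumr.
case: ifP => [_|/negbT/gibbs_out ->]; first by rewrite mulrCA.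
by rewrite !mul0r mulr0.
Qed.

Let energy_A f : wdot wI (lift f) (lift f) - wdot wI (lift f) (A *m lift f) =
  n%:R^-1 * energy w f.
Proof.
rewrite wdot_lift wdot_A.
have -> : Ex w (fun s => f s * f s) =
    n%:R^-1 * \sum_(v : vertex b h) \sum_(s : {set vertex b h} | v \notin s)
      (w s * f s ^+ 2 + w (v |: s)%SET * f (v |: s)%SET ^+ 2).
  under eq_bigr do rewrite -(big_toggle _ (fun s => w s * f s ^+ 2)).
  rewrite sumr_const -/n -[X in _ * X]mulr_natl mulKf ?gt_eqF //.
rewrite -mulrBr -sumrB; congr (_ * _); apply: eq_bigr => v _.
rewrite -sumrB; apply: eq_bigr => s _.
have := proj1 (distribution_gibbs lam_gt0 false G) s.
have := proj1 (distribution_gibbs lam_gt0 false G) (v |: s)%SET.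
move: (w s) (w _) (f s) (f _) => x y z z' y0 x0; rewrite /hm.
have [/eqP|xy] := eqVneq (x + y) 0; last by field.
rewrite paddr_eq0 // => /andP[/eqP-> /eqP->].
by rewrite !(mul0r, addr0, mulr0, expr0n) subrr.
Qed.

Let wI_gt0 i : 0 < wI i.
Proof. exact: gibbs_gt0 (enum_valP i). Qed.

Let wI_sum : \sum_i wI i = 1.
Proof.
have := wsum_lift (fun=> 1); rewrite Ex_const; last exact: distribution_gibbs.
by move=> <-; apply: eq_bigr => i _; rewrite mxE mulr1.
Qed.

Let A_rev i j : wI i * A i j = wI j * A j i.
Proof.
rewrite !mxE !mulr_sumr; apply: eq_bigr => v _.
rewrite !update_probE ?enum_valP // eq_sym /wI.
set s := enum_val i; set t := enum_val j.
case: eqP => [e|]; last by rewrite !mul0r !mulr0.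
have -> : (v |: t = v |: s)%SET.
  by rewrite -[in LHS](finset.setD1K (setU11 v t)) -[in RHS](finset.setD1K (setU11 v s));
     congr (_ |: _)%SET; apply/setP => x; move/setP/(_ x): e; rewrite !inE; case: eqP.
by rewrite e; ring.
Qed.

Let A_stoch i : \sum_j A i j = 1.
Proof.
transitivity ((A *m lift (fun=> 1)) i 0).
  by rewrite mxE; apply: eq_bigr => j _; rewrite !mxE mulr1.
rewrite A_lift -mulr_sumr (eq_bigr (fun=> 1)) => [|v _].
  by rewrite sumr_const mulVf // gt_eqF.
rewrite /hb !mulr1 divff // gt_eqF //.
have w0 s : 0 <= w s by exact: (proj1 (distribution_gibbs lam_gt0 false G)).
have [e|e] : enum_val i = (enum_val i :\ v)%SET \/ enum_val i = (v |: enum_val i)%SET.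
- have := setD1_eq v (enum_val i) (enum_val i).
  by rewrite eqxx => /esym/orP[/eqP|/eqP]; [left|right].
- by rewrite -e ltr_pwDl // gibbs_gt0 // enum_valP.
by rewrite -e ltr_wpDl // gibbs_gt0 // enum_valP.
Qed.

Let A_psd c : 0 <= wdot wI c (A *m c).
Proof.
have [f ->] := lift_surj c; rewrite wdot_A mulr_ge0 ?invr_ge0 ?ler0n //.
have w0 s : 0 <= w s by exact: (proj1 (distribution_gibbs lam_gt0 false G)).
apply: sumr_ge0 => v _; apply: sumr_ge0 => s _.
by rewrite mulr_ge0 ?sqr_ge0 // invr_ge0 addr_ge0.
Qed.

Let varE f : wdot wI (lift f) (lift f) - (\sum_i wI i * lift f i 0) ^+ 2 = Var w f.
Proof.
by rewrite wdot_lift wsum_lift.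
Qed.

Let K := 2 * (1 + lam).
Let tau := n%:R * K ^+ h.

Let K_ge1 : 1 <= K. Proof. by move: lam_gt0; rewrite /K; lra. Qed.

Let tau_gt0 : 0 < tau.
Proof. by rewrite mulr_gt0 // exprn_gt0 // (lt_le_trans ltr01). Qed.

Let A_poincare c :
  wdot wI c c - (\sum_i wI i * c i 0) ^+ 2 <=
  tau * (wdot wI c c - wdot wI c (A *m c)).
Proof.
have [f ->] := lift_surj c; rewrite varE energy_A /tau.
rewrite [leRHS](_ : _ = K ^+ h * energy w f); first exact: gibbs_poincare.
by rewrite mulrACA divff ?mul1r ?gt_eqF // mulrAC; field; rewrite gt_eqF.
Qed.

Hypothesis Omega_gt1 : (1 < #|Omega|)%N.

(** The n in front comes from the choice of a uniform vertex in each step. *)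
Lemma relaxation_time_le : relaxation_time lam G <= n%:R * K ^+ h.
Proof.
exact: (relaxation_le wI_gt0 wI_sum A_rev A_stoch tau_gt0 A_poincare A_psd Omega_gt1).
Qed.

Lemma relaxation_time_ge f eps : 0 < eps -> 0 < Var w f ->
  energy w f <= eps * Var w f -> n%:R / eps <= relaxation_time lam G.
Proof.
move=> eps0 var0 le; rewrite -[_ / _]invrK invf_div.
apply: (relaxation_ge wI_gt0 wI_sum A_rev A_stoch tau_gt0 A_poincare A_psd
  Omega_gt1 (f := lift f)); rewrite ?varE ?divr_gt0 //.
by rewrite energy_A mulrAC [_ / _]mulrC ler_pM2l // invr_gt0.
Qed.

End Chain.

Section RootOccupation.
Variables (R : realType) (b h : nat) (lam : R) (G : {set vertex b h}).
Hypotheses (lam_gt0 : 0 < lam) (Gl : G \subset leaves b h).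

Local Notation w := (gibbs lam false G).

Lemma Ex_root : Ex w (fun s => (vroot \in s)%:R) = occ lam G.
Proof.
case: h G => [|h'] G'.
  by rewrite /Ex (bigD1 G') //= eqxx mul1r big1 ?addr0 // => s /negbTE ->; rewrite mul0r.
have mP r i : distribution (gibbs lam r (branch i G')) by exact: distribution_gibbs.
rewrite Ex_node (eq_Ex _ (g := fun=> 1)) => [|x]; last by rewrite root_join.
rewrite (eq_Ex (prodw (fun i => gibbs _ false _)) (g := fun=> 0)) => [|x]; last by rewrite root_join.
by rewrite !Ex_const ?mulr1 ?mulr0 ?addr0 //; exact: distribution_prodw.
Qed.

Lemma Var_root : Var w (fun s => (vroot \in s)%:R) = occ lam G * (1 - occ lam G).
Proof.
rewrite /Var Ex_root (eq_Ex w (g := fun s => (vroot \in s)%:R)) ?Ex_root.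
  by ring.
by move=> s; case: (_ \in s); rewrite ?expr1n ?expr0n.
Qed.

End RootOccupation.

Section Height2.
Variables (R : realType) (b h : nat) (lam : R) (G : {set vertex b h.+2}).
Hypotheses (lam_gt0 : 0 < lam) (Gl : G \subset leaves b h.+2).

Local Notation w := (gibbs lam false G).

Lemma vacancy_gt0 : 0 < vacancy lam G.
Proof. by apply: prodr_gt0 => i _; rewrite unoccS // invr_gt0 odds_gt0. Qed.

Lemma occ_in01 : 0 < occ lam G < 1.
Proof.
have v0 := vacancy_gt0; have og0 := odds_gt0 lam_gt0 G.
rewrite -subr_gt0 -[X in _ && X]subr_gt0 unoccS // invr_gt0 og0 andbT subr0.
by rewrite occS divr_gt0 // mulr_gt0.
Qed.

Lemma card_configurations_gt1 : (1 < #|configurations G|)%N.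
Proof.
have wP := distribution_gibbs lam_gt0 false G.
have /andP[ og0 og1] := occ_in01; have exE := Ex_root G lam_gt0.
have [s sO rs] : exists2 s, s \in configurations G & vroot \in s.
  apply: contrapT => no; suff : Ex w (fun s => (vroot \in s)%:R) = 0.
    by move=> e; move: og0; rewrite -exE e ltxx.
  rewrite /Ex big1 // => s _; case rs: (_ \in s); last by rewrite mulr0.
  rewrite mulr1; apply: gibbs_out => //; apply/negP => sO; apply: no.
  by exists s.
have [t tO rt] : exists2 t, t \in configurations G & vroot \notin t.
  apply: contrapT => no; suff : Ex w (fun s => (vroot \in s)%:R) = 1.
    by move=> e; move: og1; rewrite -exE e ltxx.
  rewrite -[RHS](proj2 wP); apply: eq_bigr => t _; case rt: (_ \in t); first by rewrite mulr1.
  rewrite mulr0 gibbs_out //; apply/negP => tO; apply: no.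
  by exists t; rewrite ?rt.
apply/card_gt1P; exists s, t; split=> //.
by apply: contraTneq rs => ->.
Qed.

(** The root is updated once in n steps on average, and only its updates affect the
    event that it is occupied. *)
Lemma relaxation_time_ge_cardSS : #|vertex b h.+2|%:R <= relaxation_time lam G.
Proof.
rewrite -[leLHS]divr1; apply: (@relaxation_time_ge _ _ _ _ _ lam_gt0 Gl
  card_configurations_gt1 (fun s => (vroot \in s)%:R)) => //.
  have /andP[ og0 og1] := occ_in01.
  by rewrite Var_root // mulr_gt0 // subr_gt0.
by rewrite mul1r energy_mem_le //; exact: distribution_gibbs.
Qed.

End Height2.

Lemma relaxation_time_ge_card (R : realType) b h (lam : R)
    (G : {set vertex b h}) : 0 < lam -> (2 <= h)%N -> G \subset leaves b h ->
  #|vertex b h|%:R <= relaxation_time lam G.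
Proof. by case: h G => [|[|h]] // G lam_gt0 _; exact: relaxation_time_ge_cardSS. Qed.

(** * Boundary conditions close to the fixed point *)

Section Boundary.
Variables (R : realType) (b : nat) (om : R).
Hypotheses (b_gt0 : (0 < b)%N) (om_gt0 : 0 < om) (om_le : om <= 1 / 2).

Let lam := activity b om.

Let lam_gt0 : 0 < lam.
Proof. by rewrite mulr_gt0 // exprn_gt0 // addr_gt0. Qed.

Definition fill h (m : nat) (lo hi : {set vertex b h}) : {set vertex b h.+1} :=
  join false [ffun i : 'I_b => if (i < m)%N then lo else hi].

Lemma branch_fill h m (lo hi : {set vertex b h}) i :
  branch i (fill m lo hi) = if (i < m)%N then lo else hi.
Proof. by rewrite branch_join ffunE. Qed.

Lemma fill_leaves h m (lo hi : {set vertex b h}) : lo \subset leaves b h ->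
  hi \subset leaves b h -> fill m lo hi \subset leaves b h.+1.
Proof.
move=> /fintype.subsetP lol /fintype.subsetP hil; apply/fintype.subsetP => v.
case: (vertexP v) => [|i u]; first by rewrite root_join.
by rewrite vcons_join ffunE leaves_vcons; case: ifP => _; [apply: lol | apply: hil].
Qed.

Lemma vacancy_fillS h m (lo hi : {set vertex b h}) : (m < b)%N ->
  vacancy lam (fill m.+1 lo hi) * (1 - occ lam hi) =
  vacancy lam (fill m lo hi) * (1 - occ lam lo).
Proof.
move=> mb; pose j := Ordinal mb; rewrite /vacancy.
rewrite [in LHS](bigD1 j) // [in RHS](bigD1 j) //= !branch_fill.
rewrite ltnn ltnSn mulrC mulrA [RHS]mulrAC; congr (_ * _ * _).
apply: eq_bigr => i ij; rewrite !branch_fill ltnS leq_eqVlt.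
by rewrite (_ : (i == m :> nat) = false) //; apply/negbTE.
Qed.

(** Two boundary conditions for the subtrees, one on each side of the fixed
    point, are mixed in all proportions.  The product of the vacancy
    probabilities of the children then passes the value at the fixed point in
    steps of ratio at most 1 / (1 - occ hi). *)
Lemma boundary_step h (lo hi : {set vertex b h}) :
  lo \subset leaves b h -> hi \subset leaves b h ->
  1 - occ lam hi <= (1 + om)^-1 <= 1 - occ lam lo ->
  exists lo' hi' : {set vertex b h.+1},
  [/\ lo' \subset leaves b h.+1 /\ hi' \subset leaves b h.+1,
      forall i, branch i lo' \in [:: lo; hi],
      forall i, branch i hi' \in [:: lo; hi],
      lam * vacancy lam lo' <= om <= lam * vacancy lam hi' &
      lam * vacancy lam hi' * (1 - occ lam hi) <= om].
Proof.
move=> lol hil /andP[hi_le lo_ge]; pose q m := lam * vacancy lam (fill m lo hi).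
have hi0 : 0 <= 1 - occ lam hi by rewrite subr_ge0; case/andP: (occ_bounds lam_gt0 hi).
have om1 : 0 <= (1 + om)^-1 by rewrite invr_ge0 addr_ge0 // ltW.
have omE : lam * (1 + om)^-1 ^+ b = om.
  by rewrite exprVn /lam /activity mulfK // expf_neq0 // gt_eqF // addr_gt0.
have q0 : q 0%N <= om.
  rewrite -[leRHS]omE ler_pM2l // /vacancy (eq_bigr (fun=> 1 - occ lam hi)).
    by rewrite prodr_const card_ord lerXn2r.
  by move=> i _; rewrite branch_fill.
have qb : om <= q b.
  rewrite -[leLHS]omE ler_pM2l // /vacancy (eq_bigr (fun=> 1 - occ lam lo)).
    by rewrite prodr_const card_ord lerXn2r // nnegrE (le_trans om1).
  by move=> i _; rewrite branch_fill ltn_ord.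
have [m mb /andP[qm qm1]] : exists2 m, (m < b)%N & q m <= om <= q m.+1.
  have exm : exists m, om <= q m by exists b.
  have [[|m] qm min_m] := ex_minnP exm.
    exists 0%N => //; rewrite q0 (le_trans qm) //= ler_pM2l //.
    apply: ler_prod => i _; rewrite !branch_fill ltn0 hi0 /=.
    by case: ifP => // _; exact: le_trans hi_le lo_ge.
  exists m; first exact: min_m.
  by rewrite qm andbT leNgt; apply/negP => /ltW/min_m; rewrite ltnn.
exists (fill m lo hi), (fill m.+1 lo hi); split.
- by split; apply: fill_leaves.
- by move=> i; rewrite branch_fill !inE; case: ifP; rewrite eqxx ?orbT.
- by move=> i; rewrite branch_fill !inE; case: ifP; rewrite eqxx ?orbT.
- by rewrite -/(q m) -/(q m.+1) qm qm1.
rewrite -mulrA vacancy_fillS // mulrA; apply: le_trans qm.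
rewrite ler_piMr //; first by rewrite mulr_ge0 ?vacancy_ge0 // ltW.
by rewrite gerBl; case/andP: (occ_bounds lam_gt0 lo).
Qed.

Let straddles h (lo hi : {set vertex b h.+1}) :
  lam * vacancy lam lo <= om <= lam * vacancy lam hi ->
  1 - occ lam hi <= (1 + om)^-1 <= 1 - occ lam lo.
Proof.
case/andP=> lo_le hi_ge; rewrite !unoccS //.
have := odds_gt0 lam_gt0 lo; have := odds_gt0 lam_gt0 hi => ohi olo.
have om1 : 0 < 1 + om by rewrite addr_gt0.
by rewrite !lef_pV2 ?posrE // !lerD2l lo_le hi_ge.
Qed.

(** Since [om <= 1 / 2], the odds of the upper condition contract towards the
    fixed point as the height grows. *)
Lemma boundary_approx h : exists lo hi : {set vertex b h.+1},
  [/\ lo \subset leaves b h.+1, hi \subset leaves b h.+1,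
      lam * vacancy lam lo <= om <= lam * vacancy lam hi &
      lam * vacancy lam hi <= 2 * om + lam / 2 ^+ h].
Proof.
elim: h => [|h [lo [hi [lol hil str hi_le]]]].
  have [|||lo [hi [[lol hil] _ _ str _]]] :=
      @boundary_step 0 finset.set0 [set vroot]%SET.
  - exact: finset.sub0set.
  - by rewrite finset.sub1set inE.
  - have om1 : 0 < 1 + om by rewrite addr_gt0.
    rewrite /= !inE eqxx subrr subr0 invr_ge0 ltW //=.
    by rewrite invf_le1 // lerDl ltW.
  exists lo, hi; split=> //; rewrite expr0 divr1.
  apply: (@le_trans _ _ (lam * 1)); last by rewrite mulr1 lerDr mulr_ge0 // ltW.
  rewrite ler_pM2l //; apply: prodr_ile1 => i _.
  by case/andP: (occ_bounds lam_gt0 (branch i hi)) => ? ?; rewrite subr_ge0 gerBl; apply/andP.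
have [lo' [hi' [[lol' hil'] _ _ str' hi'_le]]] := boundary_step lol hil (straddles str).
exists lo', hi'; split=> //.
move: hi'_le; rewrite unoccS // ler_pdivrMr ?odds_gt0 // => /le_trans; apply.
rewrite exprS invfM; have : 0 <= lam / 2 ^+ h by rewrite divr_ge0 ?exprn_ge0 // ltW.
have := vacancy_ge0 lam_gt0 hi.
move: hi_le; rewrite [lam * (_ * _)]mulrCA.
move: (lam * vacancy lam hi) (lam / _) => x y hi_le v0 y0.
apply: (@le_trans _ _ (om * (1 + (2 * om + y)))).
  by rewrite ler_pM2l // lerD2l.
have : om * (2 * om) <= om by rewrite ler_piMr ?(ltW om_gt0) //; move: om_le; lra.
have : om * y <= 2^-1 * y by rewrite ler_wpM2r //; move: om_le; lra.
by rewrite !mulrDr; lra.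
Qed.

Section Tame.
Variable l : nat.

(** Nothing is required at height l or less, where the boundary conditions need
    not have come close to the fixed point yet. *)
Fixpoint tame k : {set vertex b (k + l).+1} -> Prop :=
  match k return {set vertex b (k + l).+1} -> Prop with
  | 0 => fun G => lam * vacancy lam G <= 3 * om
  | k'.+1 => fun G =>
      lam * vacancy lam G <= 3 * om /\ forall i, tame (branch i G)
  end.

Lemma tame_odds k (G : {set vertex b (k + l).+1}) :
  tame G -> lam * vacancy lam G <= 3 * om.
Proof. by case: k G => [|k] G //= []. Qed.

Hypothesis l_large : lam / 2 ^+ l <= om.

(** Mixing the two conditions again keeps them on both sides of the fixed point,
    with odds at most [om * (1 + 3 * om)]. *)
Lemma boundary_exists k : exists lo hi : {set vertex b (k + l).+1},
  [/\ lo \subset leaves b (k + l).+1, hi \subset leaves b (k + l).+1,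
      lam * vacancy lam lo <= om <= lam * vacancy lam hi, tame lo & tame hi].
Proof.
elim: k => [|k [lo [hi [lol hil str tlo thi]]]].
  have [lo [hi [lol hil str hi_le]]] := boundary_approx l.
  have hi3 : lam * vacancy lam hi <= 3 * om.
    by apply: le_trans hi_le _; move: l_large; lra.
  exists lo, hi; split=> //=; case/andP: str => /le_trans lo3 _.
  by apply: lo3; move: om_gt0; lra.
have [lo' [hi' [[lol' hil'] blo bhi str' hi'_le]]] :=
  boundary_step lol hil (straddles str).
have tb (G : {set vertex b (k + l).+1}) : G \in [:: lo; hi] -> tame G.
  by rewrite !inE => /orP[/eqP->|/eqP->].
have hi3 : lam * vacancy lam hi' <= 3 * om.
  move: hi'_le; rewrite unoccS // ler_pdivrMr ?odds_gt0 // => /le_trans; apply.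
  have := tame_odds thi; move: (lam * _) => x x3.
  apply: (@le_trans _ _ (om * 3)); last by rewrite mulrC.
  by rewrite ler_pM2l //; move: om_le; lra.
have lo3 : lam * vacancy lam lo' <= 3 * om.
  by case/andP: str' => /le_trans lo3 _; apply: lo3; move: om_gt0; lra.
by exists lo', hi'; split=> //=; split=> // i; exact/tb.
Qed.

End Tame.
End Boundary.

(** * Estimating the state of the root *)

Section ProductObservable.
Variables (R : realType) (b h : nat) (p : R).
Variables (m : bool -> 'I_b -> {set vertex b h} -> R) (g : {set vertex b h} -> R).
Hypotheses (p01 : 0 <= p <= 1) (mP : forall r i, distribution (m r i)).

Let f (s : {set vertex b h.+1}) : R := \prod_i g (branch i s).

Let f_join r x : f (join r x) = \prod_i g (x i).
Proof. by apply: eq_bigr => i _; rewrite branch_join. Qed.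

Lemma Ex_node_prod : Ex (node p m) f =
  p * \prod_i Ex (m true i) g + (1 - p) * \prod_i Ex (m false i) g.
Proof.
rewrite Ex_node -2!Ex_prodw_prod.
by congr (_ * _ + _ * _); apply: eq_Ex => x; rewrite f_join.
Qed.

(** A product observable with values 0 and 1 changes at coordinate i only when all
    other factors are 1. *)
Lemma energy_node_prod : (forall t, g t ^+ 2 = g t) ->
  energy (node p m) f =
  \sum_(r : bool) (if r then p else 1 - p) *
    \sum_i (\prod_(k | k != i) Ex (m r k) g) * energy (m r i) g.
Proof.
move=> g2; rewrite energy_node // big1 ?add0r => [|x _]; last first.
  by rewrite !f_join subrr expr0n mulr0.
apply: eq_bigr => r _; congr (_ * _); apply: eq_bigr => i _.
pose c k := if k == i then fun=> 1 else g.
transitivity (Ex (prodw (m r)) (fun x => energy (m r i) g * \prod_k c k (x k))).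
  apply: eq_Ex => x; rewrite (bigD1 i) //= /c eqxx mul1r.
  rewrite (eq_bigr (fun k => g (x k))) => [|k /negbTE ->//].
  rewrite (eq_energy _ (g := fun t => (\prod_(k | k != i) g (x k)) * g t)) => [|t].
    rewrite energyZ mulrC -prodrXl; congr (_ * _).
    by apply: eq_bigr => k _; rewrite g2.
  rewrite f_join (bigD1 i) //= upd_same mulrC; congr (_ * _).
  by apply: eq_bigr => k ki; rewrite upd_other.
rewrite ExZ Ex_prodw_prod mulrC; congr (_ * _).
rewrite (bigD1 i) //= /c eqxx Ex_const ?mul1r //.
by apply: eq_bigr => k /negbTE ->.
Qed.

End ProductObservable.

(** Weierstrass' product inequality. *)
Lemma prod_1m_ge (R : realDomainType) (I : Type) (r : seq I) (x : I -> R) :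
  (forall i, 0 <= x i <= 1) ->
  1 - \sum_(i <- r) x i <= \prod_(i <- r) (1 - x i) <= 1.
Proof.
move=> x01; elim: r => [|i r /andP[lo hi]]; first by rewrite !big_nil subr0 lexx.
rewrite !big_cons; have /andP[x0 x1] := x01 i.
have s0 : 0 <= \sum_(j <- r) x j by apply: sumr_ge0 => j _; case/andP: (x01 j).
have p0 : 0 <= \prod_(j <- r) (1 - x j).
  by apply: prodr_ge0 => j _; rewrite subr_ge0; case/andP: (x01 j).
move: lo hi s0 p0; move: (\sum_(j <- r) _) (\prod_(j <- r) _) => s q lo hi s0 q0.
apply/andP; split; last by nra.
have : x i * q <= x i by rewrite ler_piMr.
by lra.
Qed.

Section Estimator.
Local Arguments occ : simpl never.
Variables (R : realType) (b : nat) (om : R) (l : nat).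

Let lam := activity b om.

(** An occupied vertex has vacant children only, whereas a vacant one typically has
    an occupied child.  Applied recursively down to height l + 1, where the true
    states are used, this recovers the state of the root from far below. *)
Fixpoint est k : {set vertex b (k + l).+1} -> bool :=
  match k return {set vertex b (k + l).+1} -> bool with
  | 0 => fun s => vroot \in s
  | k'.+1 => fun s => [forall i, ~~ est (branch i s)]
  end.

Definition guess k (s : {set vertex b (k + l).+1}) : R := (est s)%:R.

Let miss k (s : {set vertex b (k + l).+1}) : R := 1 - guess s.

Lemma guessS k (s : {set vertex b (k + l).+2}) :
  @guess k.+1 s = \prod_i (1 - @guess k (branch i s)).
Proof.
rewrite /guess /=; case: forallP => [all|/forallP].
  by rewrite big1 // => i _; rewrite (negbTE (all i)) subr0.
by rewrite negb_forall => /existsP[j /negPn ej]; rewrite (bigD1 j) //= ej subrr mul0r.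
Qed.

Let B := 30 / (1 + om) ^+ b.
Let eps := b%:R * B.

Variable theta : R.
Hypotheses (b_gt0 : (0 < b)%N) (om_gt0 : 0 < om) (om_le : om <= 1 / 2).
Hypotheses (eps_le : eps <= 1 / 2) (om_eps : 3 * om * b%:R * eps <= 1).
Hypotheses (theta_gt0 : 0 < theta).
Hypothesis theta_ge : 3 * om * b%:R * eps + eps * theta <= theta ^+ 2.

Let lam_gt0 : 0 < lam.
Proof. by rewrite mulr_gt0 // exprn_gt0 // addr_gt0. Qed.

Let om1_gt0 : 0 < 1 + om. Proof. by rewrite addr_gt0. Qed.

Let B_gt0 : 0 < B. Proof. by rewrite divr_gt0 // exprn_gt0. Qed.

Let eps_gt0 : 0 < eps. Proof. by rewrite mulr_gt0 // ltr0n. Qed.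

Let P blocked k (G : {set vertex b (k + l).+1}) := Ex (gibbs lam blocked G) (@guess k).
Let D blocked k (G : {set vertex b (k + l).+1}) := energy (gibbs lam blocked G) (@guess k).

Let P01 blocked k (G : {set vertex b (k + l).+1}) : 0 <= P blocked G <= 1.
Proof.
have gP := distribution_gibbs lam_gt0 blocked G.
apply/andP; split; first by apply: Ex_ge0 => // s; exact: ler0n.
rewrite -(Ex_const gP 1); apply: ler_Ex => // s.
by rewrite /guess; case: (est s).
Qed.

Let D_ge0 blocked k (G : {set vertex b (k + l).+1}) : 0 <= D blocked G.
Proof. by apply: energy_ge0 => s; exact: (proj1 (distribution_gibbs lam_gt0 _ _)). Qed.

Let Ex_miss blocked k (G : {set vertex b (k + l).+1}) :
  Ex (gibbs lam blocked G) (@miss k) = 1 - P blocked G.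
Proof.
have gP := distribution_gibbs lam_gt0 blocked G.
rewrite (eq_Ex _ (g := fun s => 1 + -1 * guess s)) => [|s]; last by rewrite mulN1r.
by rewrite ExD ExZ Ex_const // mulN1r.
Qed.

Let energy_miss blocked k (G : {set vertex b (k + l).+1}) :
  energy (gibbs lam blocked G) (@miss k) = D blocked G.
Proof.
apply: eq_bigr => v _; apply: eq_bigr => s _; congr (_ * _).
by rewrite /miss; ring.
Qed.

Let miss2 k (s : {set vertex b (k + l).+1}) : miss s ^+ 2 = miss s.
Proof. by rewrite /miss /guess; case: (est s); rewrite ?subrr ?subr0 ?expr0n ?expr1n. Qed.

(* The recursions for P and D: by [guessS] the estimate is a product observable,
   and a subtree is pivotal when all its siblings are declared vacant. *)
Let PS blocked k (G : {set vertex b (k + l).+2}) :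
  let p := if blocked then 0 else occ lam G in
  @P blocked k.+1 G = p * \prod_i (1 - P true (branch i G)) +
    (1 - p) * \prod_i (1 - P false (branch i G)).
Proof.
move=> p; rewrite /P (eq_Ex _ (@guessS k)).
rewrite -[gibbs _ _ _]/(node p (fun r i => gibbs lam r (branch i G))).
by rewrite (Ex_node_prod p _ (@miss k)) //; congr (_ * _ + _ * _);
  apply: eq_bigr => i _; rewrite Ex_miss.
Qed.

Let DS blocked k (G : {set vertex b (k + l).+2}) :
  let p := if blocked then 0 else occ lam G in
  @D blocked k.+1 G =
    p * (\sum_i (\prod_(j | j != i) (1 - P true (branch j G))) *
         D true (branch i G)) +
    (1 - p) * (\sum_i (\prod_(j | j != i) (1 - P false (branch j G))) *
         D false (branch i G)).
Proof.
move=> p; rewrite /D (eq_energy _ (@guessS k)).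
rewrite -[gibbs _ _ _]/(node p (fun r i => gibbs lam r (branch i G))).
have mP r i : distribution (gibbs lam r (branch i G)) by exact: distribution_gibbs.
rewrite (@energy_node_prod _ _ _ p _ (@miss k)) // big_bool.
by congr (_ * _ + _ * _); apply: eq_bigr => i _; rewrite energy_miss;
  congr (_ * _); apply: eq_bigr => j _; rewrite Ex_miss.
Qed.

Let ge_occ k (G : {set vertex b (k + l).+1}) : tame om G -> occ lam G <= 3 * om.
Proof.
move/tame_odds; apply: le_trans; rewrite occS.
have x0 : 0 <= lam * vacancy lam G by rewrite mulr_ge0 ?vacancy_ge0 // ltW.
by rewrite ler_pdivrMr ?odds_gt0 // ler_peMr // lerDl.
Qed.

(** If the estimates of the children were exact, the product over all of them would
    be [vacancy lam G], which is at most [3 * om / lam = 3 / (1 + om) ^+ b].  Errors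
    cost a factor [(1 + 3 * om * eps) ^+ b <= 4], and the omission of one sibling a
    factor 5 / 2; this is the origin of the constant 30 in B. *)
Let siblings_le k (G : {set vertex b (k + l).+2}) i : @tame _ _ om l k.+1 G ->
  (forall j, occ lam (branch j G) * (1 - eps) <= P false (branch j G)) ->
  \prod_(j | j != i) (1 - P false (branch j G)) <= B.
Proof.
move=> [Gt tb] Ple.
have u0 j : 0 < 1 - occ lam (branch j G) by rewrite unoccS // invr_gt0 odds_gt0.
pose d := 1 + 3 * om * eps.
have d1 : 1 <= d by rewrite lerDl ltW // (mulr_gt0 _ eps_gt0) // mulr_gt0.
have d0 : 0 <= d by exact: le_trans d1.
have stepj j : 1 - P false (branch j G) <= (1 - occ lam (branch j G)) * d.
  have := Ple j; have := tame_odds (tb j).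
  have -> : (1 - occ lam (branch j G)) * d =
    1 - occ lam (branch j G) + (1 - occ lam (branch j G)) * (3 * om) * eps.
    by rewrite /d; ring.
  move=> odds Pj; rewrite -subr_ge0.
  have : occ lam (branch j G) * eps <= (1 - occ lam (branch j G)) * (3 * om) * eps.
    rewrite ler_pM2r // [leLHS](occ_detailed_balance lam_gt0).
    by rewrite -mulrA ler_pM2l.
  by move: Pj; lra.
have db : d ^+ b <= 4.
  have : d ^+ b <= expR 1.
    apply: (@le_trans _ _ (expR (3 * om * eps) ^+ b)).
      by rewrite lerXn2r ?nnegrE ?expR_ge0 // expR_ge1Dx.
    rewrite -expRM_natl ler_expR; apply: le_trans om_eps.
    by rewrite -mulr_natl le_eqVlt; apply/orP; left; apply/eqP; ring.
  move/le_trans; apply.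
  have e1 : expR 1 = expR 2^-1 * expR 2^-1 :> R.
    by rewrite -expRD; congr expR; field.
  rewrite e1; have := expR_ge1Dx (- 2^-1 : R); have := expRxMexpNx_1 (2^-1 : R).
  move: (expR 2^-1) (expR (- _)) (expR_gt0 (2^-1 : R)) => x y x0 xy ylo.
  have x2 : x <= 2 by nra.
  by nra.
have -> : B = 4 * (3 * om / lam) * (5 / 2).
  rewrite /B /lam /activity; field.
  by rewrite !gt_eqF // exprn_gt0.
have vacE : \prod_(j | j != i) (1 - occ lam (branch j G)) <=
    3 * om / lam * (5 / 2).
  have -> : \prod_(j | j != i) (1 - occ lam (branch j G)) =
      vacancy lam G * (1 - occ lam (branch i G))^-1.
    by rewrite /vacancy [in RHS](bigD1 i) //= mulrAC divff ?mul1r // gt_eqF.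
  apply: ler_pM; rewrite ?vacancy_ge0 ?invr_ge0 ?(ltW (u0 i)) //.
    by rewrite ler_pdivlMr // mulrC.
  rewrite unoccS // invrK.
  have : lam * vacancy lam (branch i G) <= 3 * om := tame_odds (tb i).
  by move: (lam * _) om_le => x; lra.
apply: (@le_trans _ _ (\prod_(j | j != i) ((1 - occ lam (branch j G)) * d))).
  apply: ler_prod => j _; rewrite stepj andbT subr_ge0.
  by case/andP: (P01 false (branch j G)).
rewrite big_split /= mulrC -mulrA; apply: ler_pM => //.
- by apply: prodr_ge0.
- by apply: prodr_ge0 => j _; rewrite ltW.
rewrite prodr_const; apply: le_trans db; apply: ler_weXn2l => //.
by rewrite (leq_trans (max_card _)) // card_ord.
Qed.

(** A vertex that is really occupied has vacant children, so that the estimate is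
    wrong with probability at most b times the error B below a vacant parent,
    which is eps.  In the energies the two kinds of vertices behave differently:
    below an occupied vertex all b children are pivotal with probability close to
    1, and they are vacant; below a vacant vertex each child is pivotal with
    probability at most B only, and occupied with probability of order om.  Over
    two levels the number of pivotal vertices therefore grows by a factor of order
    [b * (b * B * om)], whose square root is theta. *)
Lemma estimator_bounds k (G : {set vertex b (k + l).+1}) : tame om G ->
  [/\ P true G <= B, occ lam G * (1 - eps) <= P false G,
      D false G <= theta ^+ k & D true G <= eps * theta ^+ k / theta].
Proof.
elim: k G => [|k IH] G tG.
  have gP r := distribution_gibbs lam_gt0 r G.
  have PtE : P true G = 0.
    rewrite /P /Ex; apply: big1 => s _.
    by rewrite /guess /= /node; case: (vroot \in s); rewrite ?mulr0 ?mul0r.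
  have Vt : Var (gibbs lam true G) (@guess 0) = 0.
    rewrite /Var -/(P true G) PtE expr0n subr0 (eq_Ex _ (g := @guess 0)) //.
    by move=> s; rewrite /guess; case: (est s); rewrite ?expr0n ?expr1n.
  rewrite PtE /P Ex_root // expr0; split.
  - exact: ltW.
  - case/andP: (occ_bounds lam_gt0 G) => occ0 _.
    by rewrite ler_piMr // gerBl ltW.
  - apply: le_trans (energy_mem_le vroot (gP false)) _.
    rewrite Var_root //; case/andP: (occ_bounds lam_gt0 G) => occ0 occ1.
    by rewrite mulr_ile1 ?subr_ge0 // gerBl.
  apply: le_trans (energy_mem_le vroot (gP true)) _.
  by rewrite -[X in X <= _]/(Var _ (@guess 0)) Vt mulr1 divr_ge0 // ltW.
have [odds tb] := tG.
have IHP i : P true (branch i G) <= B by case: (IH _ (tb i)).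
have IHQ i : occ lam (branch i G) * (1 - eps) <= P false (branch i G).
  by case: (IH _ (tb i)).
have IHD i : D false (branch i G) <= theta ^+ k by case: (IH _ (tb i)).
have IHE i : D true (branch i G) <= eps * theta ^+ k / theta by case: (IH _ (tb i)).
have sib i := siblings_le i tG IHQ.
have th0 n : 0 <= theta ^+ n by rewrite exprn_ge0 // ltW.
have sumD : \sum_i (\prod_(j | j != i) (1 - P false (branch j G))) *
    D false (branch i G) <= eps * theta ^+ k.
  apply: (@le_trans _ _ (\sum_(i < b) B * theta ^+ k)).
    apply: ler_sum => i _; apply: ler_pM => //.
    by apply: prodr_ge0 => j _; rewrite subr_ge0; case/andP: (P01 false (branch j G)).
  by rewrite sumr_const card_ord -(mulr_natl (B * _)) mulrA.
have sumE : \sum_i (\prod_(j | j != i) (1 - P true (branch j G))) *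
    D true (branch i G) <= b%:R * (eps * theta ^+ k / theta).
  apply: (@le_trans _ _ (\sum_(i < b) eps * theta ^+ k / theta)).
    apply: ler_sum => i _; apply: le_trans (IHE i).
    rewrite ler_piMl //; apply: prodr_ile1 => j _.
    by case/andP: (P01 true (branch j G)) => ? ?; rewrite subr_ge0 gerBl; apply/andP.
  by rewrite sumr_const card_ord -(mulr_natl (eps * _ / _)).
have thS : theta ^+ k.+1 / theta = theta ^+ k.
  by rewrite exprSr mulfK // gt_eqF.
case/andP: (occ_bounds lam_gt0 G) => occ0 occ1.
split.
- rewrite PS mul0r add0r subr0 mul1r.
  apply: le_trans (sib (Ordinal b_gt0)); rewrite (bigD1 (Ordinal b_gt0)) //=.
  rewrite ler_piMl //.
    by apply: prodr_ge0 => j _; rewrite subr_ge0; case/andP: (P01 false (branch j G)).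
  by rewrite gerBl; case/andP: (P01 false (branch (Ordinal b_gt0) G)).
- rewrite PS /=; apply: (@le_trans _ _
    (occ lam G * \prod_i (1 - P true (branch i G)))); last first.
    rewrite lerDl mulr_ge0 ?subr_ge0 //.
    by apply: prodr_ge0 => j _; rewrite subr_ge0; case/andP: (P01 false (branch j G)).
  rewrite ler_wpM2l //.
  have /andP[lo _] := prod_1m_ge (index_enum 'I_b) (fun i => P01 true (branch i G)).
  apply: le_trans lo; rewrite lerD2l lerN2.
  apply: (@le_trans _ _ (\sum_(i < b) B)); first exact: ler_sum.
  by rewrite sumr_const card_ord -(mulr_natl B).
- rewrite DS /=; apply: (@le_trans _ _
    (3 * om * (b%:R * (eps * theta ^+ k / theta)) + 1 * (eps * theta ^+ k))).
    apply: lerD; apply: ler_pM => //; rewrite ?subr_ge0 ?gerBl //.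
    + apply: sumr_ge0 => i _; rewrite mulr_ge0 //; apply: prodr_ge0 => j _.
      by rewrite subr_ge0; case/andP: (P01 true (branch j G)).
    + exact: (@ge_occ k.+1).
    + apply: sumr_ge0 => i _; rewrite mulr_ge0 //; apply: prodr_ge0 => j _.
      by rewrite subr_ge0; case/andP: (P01 false (branch j G)).
  rewrite [leLHS](_ : _ =
    (3 * om * b%:R * eps + eps * theta) * (theta ^+ k / theta)); last first.
    by field; rewrite gt_eqF.
  rewrite [leRHS](_ : _ = theta ^+ 2 * (theta ^+ k / theta)); last first.
    by rewrite exprS; field; rewrite gt_eqF.
  by rewrite ler_wpM2r // divr_ge0 // ltW.
rewrite DS /= mul0r add0r subr0 mul1r; apply: le_trans sumD _.
by rewrite -mulrA thS.
Qed.

(** The estimate is positively correlated with the state of the root, and that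
    state has variance of order om. *)
Lemma estimator_variance k (G : {set vertex b (k + l).+2}) :
  @tame _ _ om l k.+1 G -> om <= lam * vacancy lam G ->
  om / 25 <= Var (gibbs lam false G) (@guess k.+1).
Proof.
move=> tG odds_ge; have [Pt Pf _ _] := @estimator_bounds k.+1 G tG.
have -> : Var (gibbs lam false G) (@guess k.+1) =
    @P false k.+1 G * (1 - @P false k.+1 G).
  rewrite /Var (eq_Ex _ (g := @guess k.+1)); first by rewrite /P; ring.
  by move=> s; rewrite /guess; case: (est s); rewrite ?expr0n ?expr1n.
have u_ge : 2 / 5 <= 1 - occ lam G.
  rewrite unoccS // -[2 / 5]invrK lef_pV2 ?posrE ?odds_gt0 ?invr_gt0 ?divr_gt0 //.
  rewrite invf_div.
  have : lam * vacancy lam G <= 3 * om := @tame_odds _ _ om l k.+1 G tG.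
  by move: (lam * _) om_le => x; lra.
have B_le : B <= 1 / 2.
  apply: le_trans eps_le; rewrite /eps ler_peMl ?ler1n //; exact: ltW.
case/andP: (occ_bounds lam_gt0 G) => occ0 occ1.
have P_le : @P false k.+1 G <= occ lam G + (1 - occ lam G) * B.
  rewrite PS /=; apply: lerD.
    rewrite ler_piMr //.
    by have /andP[] := prod_1m_ge (index_enum 'I_b) (fun i => P01 true (branch i G)).
  by rewrite ler_wpM2l ?subr_ge0 //; move: Pt; rewrite PS mul0r add0r subr0 mul1r.
have occ_ge : 2 / 5 * om <= occ lam G.
  rewrite (occ_detailed_balance lam_gt0) -[leRHS]mulrA.
  by apply: ler_pM => //; [rewrite divr_ge0 | exact: ltW].
have P_ge : om / 5 <= @P false k.+1 G.
  apply: le_trans Pf; have : 1 / 2 <= 1 - eps by move: eps_le; lra.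
  by move: occ_ge om_gt0; nra.
have Q_ge : 1 / 5 <= 1 - @P false k.+1 G.
  move: P_le u_ge B_le B_gt0; move: (@P _ _ _) B (occ _ _) => x y z; nra.
rewrite [leLHS](_ : _ = om / 5 * (1 / 5)); last by field.
by apply: ler_pM => //; rewrite divr_ge0 // ltW.
Qed.

End Estimator.

(** * Relaxation time in terms of the number of vertices *)

Section Sizes.
Variables (R : realType) (b : nat).
Hypothesis b_ge2 : (2 <= b)%N.

Lemma card_vertex_ge h : (b ^ h <= #|vertex b h|)%N.
Proof.
elim: h => [|h IH]; first by rewrite expn0; apply/card_gt0P; exists vroot.
by rewrite card_vertexS expnS (leq_trans (leq_mul (leqnn b) IH)) // leq_addl.
Qed.

Lemma card_vertex_le h : (#|vertex b h| <= 2 * b ^ h)%N.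
Proof.
suff : (#|vertex b h| < 2 * b ^ h)%N by exact: ltnW.
elim: h => [|h IH].
  rewrite expn0 muln1 ltnS; apply/card_le1_eqP => u v _ _.
  by apply: val_inj; case: u v => -[|? ?] // ? [] [].
rewrite card_vertexS add1n expnS mulnCA.
apply: (@leq_trans (b * #|vertex b h|.+1)%N); last by rewrite leq_mul2l IH orbT.
by rewrite mulnS -add2n leq_add2r.
Qed.

Lemma card_vertex_gt0 h : 0 < #|vertex b h|%:R :> R.
Proof. by rewrite ltr0n; apply/card_gt0P; exists vroot. Qed.

Lemma ln_b_gt0 : 0 < ln b%:R :> R.
Proof. by rewrite ln_gt0 // ltr1n. Qed.

Lemma powR_b (x : R) : b%:R `^ x = expR (x * ln b%:R).
Proof. by rewrite /powR pnatr_eq0; case: b b_ge2. Qed.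

(** Because [(1 + om) ^+ b <= expR (b * om)] and [expR (ln b)] is b. *)
Lemma activity_le (om delta : R) : 0 <= delta -> 0 < om ->
  om <= (1 + delta) * ln b%:R / b%:R ->
  activity b om <= (1 + delta) * ln b%:R * expR (delta * ln b%:R).
Proof.
move=> d0 om0 ple.
have b0 : 0 < b%:R :> R by rewrite ltr0n ltnW.
have bom : b%:R * om <= (1 + delta) * ln b%:R.
  by move: ple; rewrite ler_pdivlMr // mulrC.
have e : (1 + om) ^+ b <= expR ((1 + delta) * ln b%:R).
  apply: (@le_trans _ _ (expR om ^+ b)).
    by rewrite lerXn2r ?nnegrE ?expR_ge0 ?addr_ge0 ?expR_ge1Dx // ltW.
  by rewrite -expRM_natl ler_expR.
apply: (@le_trans _ _ ((1 + delta) * ln b%:R / b%:R * expR ((1 + delta) * ln b%:R))).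
  by apply: ler_pM => //; rewrite ?exprn_ge0 ?addr_ge0 // ltW.
rewrite mulrDl mul1r expRD lnK ?posrE // le_eqVlt; apply/orP; left; apply/eqP.
by field; rewrite gt_eqF.
Qed.

End Sizes.

(** Chosen so that b to the power [delta + upper_error delta b] bounds the Poincare
    constant [2 * (1 + lam)] of one level. *)
Definition upper_error (R : realType) (delta : R) (b : nat) : R :=
  ln (2 * (1 + (1 + delta) * ln b%:R)) / ln b%:R.

(** With h levels and n vertices, the h-th power of the constant of one level is a
    power of [b ^ h], and the latter is at most n. *)
Lemma relaxation_time_upper (R : realType) (b h : nat) (delta om : R)
    (G : {set vertex b h}) :
  (2 <= b)%N -> 0 <= delta -> 0 < om -> om <= (1 + delta) * ln b%:R / b%:R ->
  (2 <= h)%N -> G \subset leaves b h ->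
  relaxation_time (activity b om) G <=
    #|vertex b h|%:R `^ (1 + delta + upper_error delta b).
Proof.
move=> b2 d0 om0 ple; case: h G => [|[|h]] // G _ Gl.
have b0 : 0 < b%:R :> R by rewrite ltr0n ltnW.
have u0 := ln_b_gt0 R b2; set u : R := ln b%:R in u0.
have lam0 : 0 < activity b om by rewrite mulr_gt0 // exprn_gt0 // addr_gt0.
apply: le_trans (relaxation_time_le lam0 Gl (card_configurations_gt1 lam0 Gl)) _.
have n0 := card_vertex_gt0 R b h.+2; set n : R := _%:R in n0 *.
pose L : R := 2 * (1 + (1 + delta) * u).
have L1 : 1 <= L by rewrite /L; nra.
have L0 : 0 < L by exact: lt_le_trans L1.
have e0 : 0 <= delta + upper_error delta b.
  by apply: addr_ge0 => //; apply: divr_ge0; [exact: ln_ge0 | exact: ltW].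
have K_le : 2 * (1 + activity b om) <= b%:R `^ (delta + upper_error delta b).
  rewrite powR_b // -/u [(_ + upper_error _ _) * _]mulrDl /upper_error -/u -/L divfK ?gt_eqF // expRD.
  rewrite lnK ?posrE //.
  have E1 : 1 <= expR (delta * u).
    by apply: le_trans (expR_ge1Dx _); rewrite lerDl mulr_ge0 // ltW.
  have := activity_le b2 d0 om0 ple; rewrite -/u /L.
  by move: (expR _) (activity _ _) E1 => E a E1; nra.
rewrite -addrA powRD ?powRr1 ?(ltW n0) //; last by rewrite (gt_eqF n0) implybT.
rewrite ler_pM2l //.
apply: (@le_trans _ _ ((b%:R `^ (delta + upper_error delta b)) ^+ h.+2)).
  have K0 : 0 <= 2 * (1 + activity b om) by move: lam0; lra.
  by rewrite lerXn2r // nnegrE powR_ge0.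
rewrite -powR_mulrn ?powR_ge0 // powRAC powR_mulrn ?ler0n // -natrX.
by apply: ge0_ler_powR; rewrite ?nnegrE ?ler0n // ?ler_nat ?card_vertex_ge // ltW.
Qed.

Section SlowBoundary.
Variables (R : realType) (b : nat) (om theta : R).
Let eps := b%:R * (30 / (1 + om) ^+ b).
Hypotheses (b_ge2 : (2 <= b)%N) (om_gt0 : 0 < om) (om_le : om <= 1 / 2).
Hypotheses (eps_le : eps <= 1 / 2) (om_eps : 3 * om * b%:R * eps <= 1).
Hypotheses (theta_gt0 : 0 < theta).
Hypothesis theta_ge : 3 * om * b%:R * eps + eps * theta <= theta ^+ 2.

Let lam := activity b om.

Let lam_gt0 : 0 < lam.
Proof. by rewrite mulr_gt0 // exprn_gt0 // addr_gt0. Qed.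

(** The estimate of the root state has variance bounded below, while it is
    changed by an update of some vertex of height l + 1 with a rate that decays
    like theta per level. *)
Lemma slow_boundary : exists l, forall h, exists G : {set vertex b h},
  G \subset leaves b h /\ forall k, h = (k + l).+2 ->
    #|vertex b h|%:R * (om / 25) / theta ^+ k.+1 <= relaxation_time lam G.
Proof.
have b0 : (0 < b)%N by exact: ltnW.
have [l l_large] : exists l, lam / 2 ^+ l <= om.
  have [l] : exists l, lam / om <= (2 ^ l)%:R.
    have : 0 <= lam / om by rewrite divr_ge0 // ltW.
    move/archi_boundP; set N := Num.bound _ => /ltW le.
    by exists N; apply: le_trans le _; rewrite ler_nat ltnW // ltn_expl.
  rewrite natrX => le; exists l.
  by rewrite ler_pdivrMr ?exprn_gt0 // mulrC -ler_pdivrMr.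
exists l => h; have [hl|hl] := ltnP h l.+2.
  exists finset.set0; split; first exact: finset.sub0set.
  by move=> k e; move: hl; rewrite e !ltnS ltnNge leq_addl.
have hE : h = ((h - l.+2) + l).+2 by rewrite -!addnS subnK.
move: hE; move: (h - l.+2)%N => k hE; subst h => {hl}.
have [lo [G [_ Gl str _ tG]]] := boundary_exists b0 om_gt0 om_le l_large k.+1.
exists G; split=> // k' [] /addIn <- {k'}.
have varG := estimator_variance b0 om_gt0 om_le eps_le om_eps theta_gt0 theta_ge tG
  (proj2 (andP str)).
have [_ _ enG _] := estimator_bounds b0 om_gt0 om_le om_eps theta_gt0 theta_ge
  (k := k.+1) tG.
have v0 : 0 < om / 25 by rewrite divr_gt0.
have t0 : 0 < theta ^+ k.+1 by rewrite exprn_gt0.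
rewrite -mulrA -[om / 25 / _]invrK invf_div.
apply: (relaxation_time_ge lam_gt0 Gl (card_configurations_gt1 lam_gt0 Gl) _ _ _
  (f := @guess R b l k.+1)).
- by rewrite divr_gt0.
- exact: lt_le_trans varG.
apply: le_trans enG _; rewrite mulrAC ler_pdivlMr // ler_pM2l //.
Qed.

End SlowBoundary.

(** * Asymptotics in the branching factor *)

Section Asymptotics.
Variable R : realType.
Implicit Types (delta M : R) (b : nat).

Lemma near_ln_ge M : \forall b \near \oo, M <= ln b%:R :> R.
Proof.
near=> b; have le : expR M <= b%:R :> R by near: b; exact: nbhs_infty_ger.
by rewrite -[leLHS]expRK ler_ln ?posrE ?expR_gt0 // (lt_le_trans (expR_gt0 M)).
Unshelve. all: by end_near. Qed.

(** If [H u <= u ^+ 2] at [u = ln b], then [ln (H u) <= 2 * ln u]. *)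
Lemma error_bigO (F : nat -> R) (H : R -> R) :
  (\forall b \near \oo, 1 <= H (ln b%:R) <= ln b%:R ^+ 2 /\
    F b = ln (H (ln b%:R)) / ln b%:R) ->
  \forall b \near \oo, `|F b| <= 2 * `|ln (ln b%:R) / ln b%:R|.
Proof.
move=> nearH; near=> b.
have [/andP[H1 H2] ->] : 1 <= H (ln b%:R) <= ln b%:R ^+ 2 /\
    F b = ln (H (ln b%:R)) / ln b%:R by near: b.
have u1 : 1 <= ln b%:R :> R by near: b; exact: near_ln_ge.
have u0 : 0 < ln b%:R :> R by exact: lt_le_trans u1.
have H0 : 0 < H (ln b%:R) by exact: lt_le_trans H1.
have lnu : 0 <= ln (ln b%:R) :> R by exact: ln_ge0.
have div0 (x : R) : 0 <= x -> 0 <= x / ln b%:R by move=> x0; exact: divr_ge0 x0 (ltW u0).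
rewrite !ger0_norm ?div0 ?ln_ge0 // mulrA ler_pM2r ?invr_gt0 //.
have : ln (H (ln b%:R)) <= ln (ln b%:R ^+ 2) by rewrite ler_ln ?posrE ?exprn_gt0.
by rewrite lnXn // mulr_natl.
Unshelve. all: by end_near. Qed.

Lemma upper_error_bigO delta : 0 <= delta ->
  (upper_error delta : nat -> R^o) =O_\oo
    (fun b => ln (ln b%:R) ^+ 2 / ln b%:R : R^o).
Proof.
move=> d0; apply/eqO_exP; exists 2 => //.
have nearH : \forall b \near \oo,
    1 <= 2 * (1 + (1 + delta) * ln b%:R) <= ln b%:R ^+ 2 /\
    upper_error delta b = ln (2 * (1 + (1 + delta) * ln b%:R)) / ln b%:R.
  near=> b; split=> //.
  have u4 : 4 + 2 * delta <= ln b%:R :> R by near: b; exact: near_ln_ge.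
  by apply/andP; split; nra.
have err := error_bigO (H := fun u => 2 * (1 + (1 + delta) * u)) nearH.
near=> b; have le : `|upper_error delta b| <= 2 * `|ln (ln b%:R) / ln b%:R|.
  by near: b.
have u : expR 1 <= ln b%:R :> R by near: b; exact: near_ln_ge.
have u0 : 0 < ln b%:R :> R by exact: lt_le_trans (expR_gt0 1) u.
have lnu : 1 <= ln (ln b%:R) :> R by rewrite -[leLHS]expRK ler_ln ?posrE ?expR_gt0.
apply: le_trans le _; rewrite ler_pM2l //.
have l0 : 0 <= ln (ln b%:R) :> R by exact: le_trans lnu.
have div0 (x : R) : 0 <= x -> 0 <= x / ln b%:R by move=> x0; exact: divr_ge0 x0 (ltW u0).
rewrite !ger0_norm ?div0 ?exprn_ge0 // ler_pM2r ?invr_gt0 //.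
by rewrite expr2 ler_peMl.
Unshelve. all: by end_near. Qed.

(** With w = (1 + delta) u and y = b ^ (- delta / 2), where u = ln b, the error eps
    is at most 60 y^2, so that [3 * w * eps + eps * theta] is at most 240 w y^2.
    The constant 480 puts this below the square of theta = 480 w y, and makes the
    errors small as soon as theta is at most 1. *)
Definition slow_rate delta : R := 480 * (1 + delta).

(** The second condition says that theta = [slow_rate delta * u * b ^ (- delta / 2)],
    with u = ln b, is at most 1, and the third one that [b * om ^+ 2 <= 1 / 2] for
    [om = (1 + delta) * u / b]. *)
Definition slow_regime delta b : bool :=
  [&& 1 <= ln b%:R :> R,
      slow_rate delta * ln b%:R <= expR (delta / 2 * ln b%:R) &
      2 * ((1 + delta) * ln b%:R) ^+ 2 <= b%:R].

(** In the slow regime theta is b to the power [lower_error delta b - delta / 2].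
    For the remaining b the exponent of n becomes 1. *)
Definition lower_error delta b : R :=
  if slow_regime delta b then ln (slow_rate delta * ln b%:R) / ln b%:R
  else delta / 2.

Lemma near_slow_regime delta : 0 < delta -> \forall b \near \oo, slow_regime delta b.
Proof.
move=> d0; near=> b.
have u1 : 1 <= ln b%:R :> R by near: b; exact: near_ln_ge.
have u2 : 8 * slow_rate delta / delta ^+ 2 <= ln b%:R by near: b; exact: near_ln_ge.
have u3 : 12 * (1 + delta) ^+ 2 <= ln b%:R :> R by near: b; exact: near_ln_ge.
have b0 : 0 < b%:R :> R.
  rewrite ltr0n lt0n; apply/eqP => b0.
  by move: u1; rewrite b0 ln0 // leNgt ltr01.
have bE : b%:R = expR (ln b%:R) :> R by rewrite lnK.
apply/and3P; split=> //.
  have x0 : 0 <= delta / 2 * ln b%:R by apply: mulr_ge0; [rewrite divr_ge0 // ltW | exact: le_trans u1].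
  apply: le_trans (expR_ge1Dxn 1 x0); move: u2.
  rewrite ler_pdivrMr ?exprn_gt0 // (_ : (2`!)%:R = 2 :> R) //.
  by move: (slow_rate _) (ln _) u1 => C u u1; nra.
rewrite [leRHS]bE; have u0 : 0 <= ln b%:R :> R by exact: le_trans u1.
apply: le_trans (expR_ge1Dxn 2 u0); rewrite (_ : (3`!)%:R = 6 :> R) //.
rewrite exprMn; move: u3; move: ((1 + delta) ^+ 2) (ln _) u1 => s u u1 u3.
have : 12 * s * u ^+ 2 <= u ^+ 3.
  by rewrite [leRHS]exprS ler_wpM2r // exprn_ge0 // (le_trans ler01).
by lra.
Unshelve. all: by end_near. Qed.

Lemma lower_error_bigO delta : 0 < delta ->
  (lower_error delta : nat -> R^o) =O_\oo
    (fun b => ln (ln b%:R) / ln b%:R : R^o).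
Proof.
move=> d0; apply/eqO_exP; exists 2 => //.
apply: (error_bigO (H := fun u => slow_rate delta * u)); near=> b.
have C1 : 1 <= slow_rate delta by rewrite /slow_rate; have := d0; lra.
have u1 : 1 <= ln b%:R :> R by near: b; exact: near_ln_ge.
have uC : slow_rate delta <= ln b%:R by near: b; exact: near_ln_ge.
have reg : slow_regime delta b by near: b; exact: (near_slow_regime d0).
rewrite /lower_error reg; split=> //; apply/andP; split.
  by rewrite (le_trans C1) // ler_peMr // (le_trans ler01).
by rewrite expr2 ler_wpM2r // (le_trans ler01).
Unshelve. all: by end_near. Qed.

(** The number of vertices is at most [2 * b ^ h], so the decay theta per level of
    the test function is the power [lower_error delta b - delta / 2] of n, up to
    a constant. *)
Lemma slow_boundary_in_regime delta b : 0 < delta -> (2 <= b)%N ->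
  slow_regime delta b ->
  let om := (1 + delta) * ln b%:R / b%:R in
  exists2 G : (forall h, {set vertex b h}),
    (forall h, G h \subset leaves b h) &
    exists2 c : R, 0 < c & \forall h \near \oo,
      c * #|vertex b h|%:R `^ (1 + delta / 2 - lower_error delta b)
        <= relaxation_time (activity b om) (G h).
Proof.
move=> d0 b2 reg om; rewrite /lower_error reg.
case/and3P: reg; set u : R := ln b%:R => u1 Cu_le su_le.
have u0 : 0 < u by exact: lt_le_trans u1.
have b0 : 0 < b%:R :> R by rewrite ltr0n ltnW.
have b2R : 2 <= b%:R :> R by rewrite (ler_nat R 2).
pose w := (1 + delta) * u; pose y := expR (- (delta / 2 * u)).
pose theta := 480 * w * y; pose rho := delta / 2 - ln (slow_rate delta * u) / u.
have w1 : 1 <= w by rewrite /w; nra.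
have w0 : 0 < w by exact: lt_le_trans w1.
have y0 : 0 < y by exact: expR_gt0.
have CuE : slow_rate delta * u = 480 * w by rewrite /slow_rate /w mulrA.
have thetaE : theta = expR (- (rho * u)).
  rewrite /theta -CuE /rho mulrBl divfK ?gt_eqF // opprB expRD lnK //.
  by rewrite posrE CuE mulr_gt0.
have theta0 : 0 < theta by rewrite thetaE expR_gt0.
have theta1 : theta <= 1.
  rewrite /theta -CuE /y expRN ler_pdivrMr ?expR_gt0 // mul1r.
  exact: Cu_le.
have om0 : 0 < om by rewrite divr_gt0.
have bom : b%:R * om = w by rewrite /om mulrC divfK ?gt_eqF.
have bom2 : b%:R * om ^+ 2 <= 1 / 2.
  rewrite expr2 mulrA bom /om -/w mulrA ler_pdivrMr // -expr2.
  by move: su_le; rewrite -/w; lra.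
have om_le : om <= 1 / 2 by nra.
(* From [(1 + om) * (1 - om + om ^+ 2) = 1 + om ^+ 3]. *)
have om_exp : expR (om - om ^+ 2) <= 1 + om.
  have : 1 - om + om ^+ 2 <= expR (om ^+ 2 - om) by apply: le_trans (expR_ge1Dx _); lra.
  have := expRxMexpNx_1 (om - om ^+ 2); rewrite opprB.
  move: (expR _) (expR _) (expR_gt0 (om - om ^+ 2)) => x' x x0 xx' x'_ge.
  have : (1 - om + om ^+ 2) * x <= 1 by rewrite -[leRHS]xx' mulrC ler_pM2l.
  have : 1 <= (1 + om) * (1 - om + om ^+ 2) by nra.
  have : 0 < 1 - om + om ^+ 2 by nra.
  move: (1 - om + om ^+ 2) => z z0 z1 zx.
  by rewrite -(ler_pM2r z0) mulrC (le_trans zx).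
have y2E : y ^+ 2 = expR (- (delta * u)).
  by rewrite expr2 -expRD; congr expR; field.
have pow_ge : b%:R / (2 * y ^+ 2) <= (1 + om) ^+ b.
  apply: (@le_trans _ _ (expR (om - om ^+ 2) ^+ b)); last first.
    by rewrite lerXn2r ?nnegrE ?expR_ge0 ?addr_ge0 // ltW.
  rewrite -expRM_natl mulrBr bom expRD.
  have half : 1 / 2 <= expR (- (b%:R * om ^+ 2)).
    by apply: le_trans (expR_ge1Dx _); move: bom2; lra.
  have wE : expR w = b%:R / y ^+ 2.
    by rewrite y2E expRN invrK /w mulrDl mul1r expRD lnK.
  rewrite wE invfM mulrA mulrAC ler_pM2l; last by rewrite divr_gt0 // exprn_gt0.
  by rewrite -div1r.
pose eps := b%:R * (30 / (1 + om) ^+ b).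
have eps0 : 0 < eps by rewrite mulr_gt0 // divr_gt0 // exprn_gt0 // addr_gt0.
have eps_y : eps <= 60 * y ^+ 2.
  rewrite /eps mulrA ler_pdivrMr; last by rewrite exprn_gt0 // addr_gt0.
  move: pow_ge; rewrite ler_pdivrMr ?mulr_gt0 ?exprn_gt0 //.
  by move: (_ ^+ b) => p; lra.
have yw : 480 * (w * y) <= 1 by move: theta1; rewrite /theta mulrA.
have yw_y : y <= w * y by rewrite ler_peMl // ltW.
have eps_le : eps <= 1 / 2 by nra.
have omE : 3 * om * b%:R * eps = 3 * w * eps by rewrite -bom; ring.
have w_eps : 3 * w * eps <= 180 * w * y ^+ 2 by nra.
have om_eps : 3 * om * b%:R * eps <= 1.
  by rewrite omE; apply: le_trans w_eps _; nra.
have theta_ge : 3 * om * b%:R * eps + eps * theta <= theta ^+ 2.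
  have et : eps * theta <= 60 * y ^+ 2 by apply: le_trans eps_y; rewrite ler_piMr // ltW.
  have wy : y ^+ 2 <= w * y ^+ 2 by rewrite ler_peMl // exprn_ge0 // ltW.
  have wwy : w * y ^+ 2 <= w ^+ 2 * y ^+ 2.
    by rewrite ler_pM2r ?exprn_gt0 // expr2 ler_peMl // ltW.
  rewrite omE (_ : theta ^+ 2 = 480 ^+ 2 * (w ^+ 2 * y ^+ 2)); last first.
    by rewrite /theta; ring.
  by lra.
have [l ex] := slow_boundary b2 om0 om_le eps_le om_eps theta0 theta_ge.
exists (fun h => projT1 (cid (ex h))) => [h|].
  by case: (cid _) => G [].
have lb0 : 0 < 2 * b%:R ^+ l.+1 :> R by rewrite mulr_gt0 // exprn_gt0.
have rho0 : 0 <= rho.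
  rewrite -(pmulr_lge0 _ u0) -oppr_le0 -expR_le1 -thetaE //.
exists (om / 25 / (2 * b%:R ^+ l.+1) `^ rho) => [|].
  by rewrite divr_gt0 ?powR_gt0 // divr_gt0.
near=> h; case: (cid _) => /= G [_ GT].
have hl : (l.+2 <= h)%N by near: h; exact: nbhs_infty_ge.
have hE : h = ((h - l.+2) + l).+2 by rewrite -!addnS subnK.
apply: le_trans (GT _ hE); move: (h - l.+2)%N hE => k hE {GT}.
have n0 := card_vertex_gt0 R b h; set n : R := _%:R in n0 *.
have n_le : n <= 2 * b%:R ^+ l.+1 * b%:R ^+ k.+1.
  rewrite -mulrA -exprD (_ : (l.+1 + k.+1)%N = h) -?natrX -?natrM ?ler_nat; last first.
    by rewrite hE addSn addnS addnC.
  exact: card_vertex_le.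
have nrho : n `^ rho <= (2 * b%:R ^+ l.+1) `^ rho / theta ^+ k.+1.
  apply: (@le_trans _ _ ((2 * b%:R ^+ l.+1 * b%:R ^+ k.+1) `^ rho)).
    by apply: ge0_ler_powR => //; rewrite nnegrE ltW // mulr_gt0 // exprn_gt0.
  rewrite powRM ?exprn_ge0 ?(ltW b0) ?(ltW lb0) // ler_pM2l ?powR_gt0 //.
  rewrite -(powR_mulrn k.+1 (ltW b0)) powRAC powR_mulrn ?powR_ge0 //.
  by rewrite powR_b // -/u thetaE -exprVn -expRN opprK.
rewrite -addrA -/rho [n `^ _]powRD ?powRr1 ?(ltW n0) //; last by rewrite (gt_eqF n0) implybT.
rewrite [leLHS](_ : _ = n * (om / 25) * (n `^ rho / (2 * b%:R ^+ l.+1) `^ rho)); last by ring.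
rewrite -[leRHS]mulrA -[leLHS]mulrA ler_pM2l // ler_pM2l ?divr_gt0 //.
by rewrite ler_pdivrMr ?powR_gt0 // mulrC.
Unshelve. all: by end_near. Qed.

End Asymptotics.

Theorem theorem1 (R : realType) :
  (exists f : nat -> R^o,
    f =O_\oo (fun b => ln (ln b%:R) ^+ 2 / ln b%:R : R^o) /\
    forall (b : nat) (omega : R),
      (2 <= b)%N -> 0 < omega -> omega <= ln b%:R / b%:R ->
      (exists2 c : R, 0 < c &
        \forall h \near \oo, forall G : {set vertex b h}, G \subset leaves b h ->
          c * #|vertex b h|%:R <= relaxation_time (activity b omega) G) /\
      (exists2 C : R, 0 < C &
        \forall h \near \oo, forall G : {set vertex b h}, G \subset leaves b h ->
          relaxation_time (activity b omega) G
            <= C * #|vertex b h|%:R `^ (1 + f b)))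
  /\
  (forall delta : R, 0 < delta ->
    (exists f : nat -> R^o,
      f =O_\oo (fun b => ln (ln b%:R) ^+ 2 / ln b%:R : R^o) /\
      forall b : nat, (2 <= b)%N ->
        let omega := (1 + delta) * ln b%:R / b%:R in
        exists2 C : R, 0 < C &
          \forall h \near \oo, forall G : {set vertex b h}, G \subset leaves b h ->
            relaxation_time (activity b omega) G
              <= C * #|vertex b h|%:R `^ (1 + delta + f b)) /\
    (exists g : nat -> R^o,
      g =O_\oo (fun b => ln (ln b%:R) / ln b%:R : R^o) /\
      forall b : nat, (2 <= b)%N ->
        let omega := (1 + delta) * ln b%:R / b%:R in
        exists2 G : (forall h : nat, {set vertex b h}),
          (forall h, G h \subset leaves b h) &
          exists2 c : R, 0 < c &
            \forall h \near \oo,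
              c * #|vertex b h|%:R `^ (1 + delta / 2 - g b)
                <= relaxation_time (activity b omega) (G h))).
Proof.
split.
  exists (@upper_error R 0); split; first exact: upper_error_bigO.
  move=> b om b2 om0 ple; split.
    exists 1 => //; near=> h => G Gl; rewrite mul1r.
    have h2 : (2 <= h)%N by near: h; exact: nbhs_infty_ge.
    apply: relaxation_time_ge_card => //.
    by rewrite mulr_gt0 // exprn_gt0 // addr_gt0.
  exists 1 => //; near=> h => G Gl; rewrite mul1r.
  have h2 : (2 <= h)%N by near: h; exact: nbhs_infty_ge.
  have := @relaxation_time_upper _ _ _ 0 om G b2 (lexx 0) om0 _ h2 Gl.
  by rewrite !addr0 mul1r => /(_ ple).
move=> delta d0; split.
  exists (@upper_error R delta); split; first exact/upper_error_bigO/ltW.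
  move=> b b2 om; exists 1 => //; near=> h => G Gl; rewrite mul1r.
  have h2 : (2 <= h)%N by near: h; exact: nbhs_infty_ge.
  apply: relaxation_time_upper => //; first exact: ltW.
  by rewrite divr_gt0 ?mulr_gt0 ?ln_b_gt0 ?addr_gt0 // ltr0n ltnW.
exists (@lower_error R delta); split; first exact: lower_error_bigO.
move=> b b2; have [reg|nreg] := boolP (slow_regime delta b).
  exact: slow_boundary_in_regime.
move=> om; exists (fun h => finset.set0) => [h|]; first exact: finset.sub0set.
exists 1 => //; near=> h; rewrite mul1r /lower_error (negbTE nreg) addrK powRr1 ?ler0n //.
have h2 : (2 <= h)%N by near: h; exact: nbhs_infty_ge.
apply: relaxation_time_ge_card => //; last exact: finset.sub0set.
rewrite mulr_gt0 ?exprn_gt0 ?addr_gt0 //.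
  by rewrite divr_gt0 ?mulr_gt0 ?ln_b_gt0 ?addr_gt0 // ltr0n ltnW.
by rewrite divr_gt0 ?mulr_gt0 ?ln_b_gt0 ?addr_gt0 // ltr0n ltnW.
Unshelve. all: by end_near. Qed.
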